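(* Any square-celled disk $M$ that fills isometrically a cycle graph of length $2n$ has at least $\frac{n(n-1)}2$ square cells.
   Context: A compact square-celled surface is a surface $M$ obtained from a finite set of squares by choosing some disjoint pairs of sides (a pair may consist of two sides of the same square) and gluing each pair by an affine bijection. Its vertices, edges and square cells form sets $M^0,M^1,M^2$ (vertices or edges of the squares are regarded as equal if they are glued together); its 1-skeleton is the graph $M^{\le1}=(M^0,M^1)$ (loops and multiple edges allowed). Its boundary is the subgraph formed by the unpaired sides. A square-celled disk is a square-celled surface homeomorphic to a closed disk. For vertices $x,y$, $d_{M^{\le 1}}(x,y)$ is the minimum number of edges of a path from $x$ to $y$ in $M^{\le 1}$. Let $C=C_{2n}$ be the cycle graph of length $2n$, with graph distance $d_C$. $M$ fills $C$ isometrically if $\partial M=C$ and $d_{M^{\le1}}(x,y)=d_C(x,y)$ for all vertices $x,y$ of $\partial M$. *)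

(* Defs.v *)
From HB Require Import structures.
From Stdlib Require Import Relations.
From mathcomp Require Import all_boot all_order all_algebra generic_quotient.
From mathcomp Require Import boolp classical_sets reals topology normedtype.
Import numFieldNormedType.Exports.

Set Implicit Arguments.
Unset Strict Implicit.
Unset Printing Implicit Defensive.

Import Order.TTheory GRing.Theory Num.Theory.

Record multigraph := Multigraph {
  vtx : finType;
  edg : finType;
  ends : edg -> {set vtx} (* a singleton for a loop *)
}.

Definition adj (G : multigraph) : rel (vtx G) :=
  fun x y => [exists e, ends e == [set x; y]].

Definition has_path (G : multigraph) (x y : vtx G) (k : nat) : bool :=
  [exists p : k.-tuple (vtx G), path (@adj G) x p && (last x p == y)].

(** [None] stands for an infinite distance. *)
Definition dist (G : multigraph) (x y : vtx G) : option nat :=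
  if pselect (exists k, has_path x y k) is left h then Some (ex_minn h)
  else None.

Record graph_iso (G H : multigraph) := GraphIso {
  iso_vtx :> vtx G -> vtx H;
  iso_edg : edg G -> edg H;
  iso_vtx_bij : bijective iso_vtx;
  iso_edg_bij : bijective iso_edg;
  iso_ends : forall e, ends (iso_edg e) = [set iso_vtx x | x in ends e]
}.

(** [ordS] is the cyclic successor: edge [i] joins [i] and [i + 1] mod [m]. *)
Definition cycle_graph (m : nat) : multigraph :=
  @Multigraph 'I_m 'I_m (fun i => [set i; ordS i]).

(** The sides of a square, and also its corners, are indexed cyclically by
    ['I_4]; side [i] goes from corner [i] to corner [i + 1].

    [mate] exchanges the two sides of each pair, and its fixed points are the
    unpaired sides. Each side is parametrised affinely by [0, 1] from its first
    to its second corner. There are exactly two affine bijections between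
    two sides: [t |-> t], for [flip s = false], and [t |-> 1 - t], for
    [flip s = true]. The value of [flip] on an unpaired side is irrelevant. *)
Record square_surface := SquareSurface {
  cell : finType;
  mate : cell * 'I_4 -> cell * 'I_4;
  mateK : involutive mate;
  flip : cell * 'I_4 -> bool;
  flip_mate : forall s, flip (mate s) = flip s
}.

Section Surface.
Variable M : square_surface.

Definition side : finType := (cell M * 'I_4)%type.
Definition corner : finType := (cell M * 'I_4)%type.

Definition side_end (s : side) (b : bool) : corner :=
  (s.1, if b then ordS s.2 else s.2).

Definition corner_glue : rel corner := fun c c' =>
  [exists s : side, exists b : bool, [&& mate s != s, c == side_end s b
                                      & c' == side_end (mate s) (b (+) flip s)]].

Lemma corner_glue_sym : symmetric corner_glue.
Proof.
have H c c' : corner_glue c c' -> corner_glue c' c.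
  move=> /existsP[s /existsP[b /and3P[ms cE c'E]]].
  apply/existsP; exists (mate s); apply/existsP; exists (b (+) flip s).
  by rewrite mateK eq_sym ms c'E flip_mate -addbA addbb addbF.
by move=> c c'; apply/idP/idP; apply: H.
Qed.

Definition same_vertex : rel corner := connect corner_glue.

Lemma same_vertex_refl : reflexive same_vertex.
Proof. exact: connect0. Qed.
Lemma same_vertex_sym : symmetric same_vertex.
Proof. by apply: sym_connect_sym; exact: corner_glue_sym. Qed.
Lemma same_vertex_trans : transitive same_vertex.
Proof. exact: connect_trans. Qed.
Definition same_vertex_equiv :=
  EquivRel same_vertex same_vertex_refl same_vertex_sym same_vertex_trans.

Definition vertex : finType := quot_type {eq_quot same_vertex_equiv}%qT.
Definition vertex_of (c : corner) : vertex := (\pi_{eq_quot same_vertex_equiv} c)%qT.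

Definition same_edge : rel side := fun s t => (t == s) || (t == mate s).

Lemma same_edge_refl : reflexive same_edge.
Proof. by move=> s; rewrite /same_edge eqxx. Qed.
Lemma same_edge_sym : symmetric same_edge.
Proof.
move=> s t; rewrite /same_edge (eq_sym t s); congr orb.
by apply/eqP/eqP => ->; rewrite mateK.
Qed.
Lemma same_edge_trans : transitive same_edge.
Proof.
move=> t s u; rewrite /same_edge.
move=> /orP[] /eqP-> /orP[] /eqP->; rewrite ?mateK ?eqxx ?orbT //.
Qed.
Definition same_edge_equiv :=
  EquivRel same_edge same_edge_refl same_edge_sym same_edge_trans.

Definition edge : finType := quot_type {eq_quot same_edge_equiv}%qT.
Definition edge_of (s : side) : edge := (\pi_{eq_quot same_edge_equiv} s)%qT.

Definition edge_ends (e : edge) : {set vertex} :=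
  \bigcup_(s : side | edge_of s == e)
    [set vertex_of (side_end s false); vertex_of (side_end s true)].

Definition skeleton : multigraph := Multigraph edge_ends.

Definition boundary_edges : {set edge} :=
  [set edge_of s | s in [pred s : side | mate s == s]].

Definition boundary_vertices : {set vertex} :=
  \bigcup_(e in boundary_edges) edge_ends e.

Definition boundary : multigraph :=
  @Multigraph {v : vertex | v \in boundary_vertices}
              {e : edge | e \in boundary_edges}
              (fun e => [set v | val v \in edge_ends (val e)]).

End Surface.

Definition fills_isometrically (M : square_surface) (C : multigraph) : Prop :=
  exists f : graph_iso C (boundary M),
    forall x y : vtx C,
      @dist (skeleton M) (val (f x)) (val (f y)) = dist x y.

Definition homeomorphic (X Y : topologicalType) : Prop :=
  exists (f : X -> Y) (g : Y -> X),
    [/\ cancel f g, cancel g f, continuous f & continuous g].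

Local Open Scope ring_scope.
Local Open Scope classical_set_scope.

Section Space.
Variables (R : realType) (M : square_surface).

Definition unit_square : set (R * R) :=
  [set p | 0 <= p.1 <= 1 /\ 0 <= p.2 <= 1].

(** Corners 0, 1, 2, 3 are (0,0), (1,0), (1,1), (0,1). *)
Definition side_param (i : 'I_4) (t : R) : R * R :=
  match val i with
  | 0%N => (t, 0)
  | 1%N => (1, t)
  | 2%N => (1 - t, 1)
  | _ => (0, 1 - t)
  end.

Definition squares : topologicalType := {q : cell M & set_type unit_square}.

Definition point_glue (x y : squares) : Prop :=
  exists (s : side M) (t : R), [/\ 0 <= t <= 1, mate s != s,
    tag x = s.1 /\ val (tagged x) = side_param s.2 t
  & tag y = (mate s).1 /\
    val (tagged y) = side_param (mate s).2 (if flip s then 1 - t else t)].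

Definition same_point : rel squares :=
  fun x y => `[< clos_refl_sym_trans squares point_glue x y >].

Lemma same_point_refl : reflexive same_point.
Proof. by move=> x; apply/asboolP; exact: rst_refl. Qed.
Lemma same_point_sym : symmetric same_point.
Proof. by move=> x y; apply/asboolP/asboolP; exact: rst_sym. Qed.
Lemma same_point_trans : transitive same_point.
Proof.
by move=> y x z /asboolP xy /asboolP yz; apply/asboolP; exact: rst_trans xy yz.
Qed.
Definition same_point_equiv :=
  EquivRel same_point same_point_refl same_point_sym same_point_trans.

Definition surface_space : topologicalType :=
  quotient_topology {eq_quot same_point_equiv}%qT.

Definition closed_disk : topologicalType :=
  set_type [set p : R * R | p.1 ^+ 2 + p.2 ^+ 2 <= 1].

Definition is_disk : Prop := homeomorphic surface_space closed_disk.

End Space.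

(* Main.v *)
Require Import Defs.
From Stdlib Require Import Relations.
From mathcomp Require Import boolp classical_sets functions reals topology normedtype.
From mathcomp Require Import all_boot all_order all_algebra generic_quotient.
From mathcomp Require Import ring lra zify.
Import numFieldNormedType.Exports.

(** The 1-skeleton is bipartite, because the constant cocycle 1 mod 2 is a
    coboundary on a disk.  Hence, if [p_i] ([i] mod [2n]) are the boundary
    vertices, every vertex [v] lies on one definite side [a_i v] of the "wall"
    that compares [d (p_i, v)] with [d (p_(i+1), v)].  As the filling is
    isometric, wall [i] meets the boundary exactly at the edges [i] and
    [i + n], so two walls [i], [j] with [j <> i], [j <> i + n] separate each
    other's ends and have to cross oddly often inside some square.

    Conversely a square is crossed by few pairs of walls.  If walls [i] and [j]
    cross an edge [uv] in the same direction, then geodesics from [p_i] and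
    [p_j] to [u], and from [p_(i+1)] and [p_(j+1)] to [v], form two paths with
    interlaced ends on the boundary.  These paths meet, since H_1 of a disk
    vanishes mod 2, but at a common vertex both ends of [uv] would be the
    nearer one.  So each edge is crossed at most once in each direction, which
    allows at most 4 crossing pairs per square, and
    [2 n (n - 1) <= 4 * #squares].

    The only topological input is H^1 (M; Z/2) = 0.  A mod 2 cocycle is turned
    into a real line bundle on the surface, given by rank one matrices
    [P x = u u^T] with [u] defined up to sign.  On a disk this bundle has a
    nowhere zero section: apply [P] successively to a vector while walking
    along a fine subdivision of a radius.  The signs of the section in the
    squares trivialise the cocycle. *)

Set Implicit Arguments.
Unset Strict Implicit.
Unset Printing Implicit Defensive.

Import Order.TTheory GRing.Theory Num.Theory.

(** * Distances in a multigraph *)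

Section Metric.
Variable G : multigraph.
Implicit Types x y z : vtx G.

Lemma adj_sym : symmetric (@adj G).
Proof. by move=> x y; apply/existsP/existsP => -[e /eqP eE]; exists e; rewrite eE setUC. Qed.

Lemma has_pathP x y k :
  reflect (exists p, [/\ path (@adj G) x p, last x p = y & size p = k]) (has_path x y k).
Proof.
apply: (iffP existsP) => [[p /andP[xp /eqP <-]]|[p [xp <- <-]]].
  by exists p; rewrite size_tuple.
by exists (in_tuple p); rewrite xp eqxx.
Qed.

Lemma has_path_cat x y z k l :
  has_path x y k -> has_path y z l -> has_path x z (k + l).
Proof.
move=> /has_pathP[p [xp <- <-]] /has_pathP[q [yq <- <-]].
by apply/has_pathP; exists (p ++ q); rewrite cat_path xp yq last_cat size_cat.
Qed.

Lemma has_path_sym x y k : has_path x y k -> has_path y x k.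
Proof.
move=> /has_pathP[p [xp <- <-]]; apply/has_pathP; exists (rev (belast x p)).
rewrite size_rev size_belast rev_path; split=> //.
  by rewrite (eq_path (e' := @adj G)) // => a b; rewrite adj_sym.
by case: (p) => //= a q; rewrite rev_cons last_rcons.
Qed.

Definition linked x y := exists k, has_path x y k.

(** The default 0 at unlinked pairs makes any strict inequality [k < distn x y] a proof that [x] and
    [y] are linked. *)
Definition distn x y : nat := odflt 0 (dist x y).

Lemma distP x y : linked x y -> dist x y = Some (distn x y).
Proof. by rewrite /distn /dist; case: pselect => // h _; case: pselect. Qed.

Lemma distn_path x y : linked x y -> has_path x y (distn x y).
Proof. by rewrite /distn /dist; case: pselect => // h _ /=; case: ex_minnP. Qed.

Lemma distn_le x y k : has_path x y k -> distn x y <= k.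
Proof.
move=> xy; rewrite /distn /dist; case: pselect => [h|[]]; last by exists k.
by rewrite /=; case: ex_minnP => l _ /(_ k xy).
Qed.

Lemma distn_unlinked x y : ~ linked x y -> distn x y = 0.
Proof. by rewrite /distn /dist => xy; case: pselect. Qed.

Lemma linked_sym x y : linked x y -> linked y x.
Proof. by case=> k /has_path_sym; exists k. Qed.

Lemma linked_trans x y z : linked x y -> linked y z -> linked x z.
Proof. by case=> k xy [l yz]; exists (k + l); exact: has_path_cat xy yz. Qed.

Lemma linked_adj x y : adj x y -> linked x y.
Proof. by move=> xy; exists 1; apply/has_pathP; exists [:: y]; rewrite /= xy. Qed.

Lemma distn_triangle x y z :
  linked x y -> linked y z -> distn x z <= distn x y + distn y z.
Proof.
by move=> xy yz; apply: distn_le; apply: has_path_cat; exact: distn_path.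
Qed.

Lemma distn_sym x y : distn x y = distn y x.
Proof.
have [xy|xy] := pselect (linked x y).
  have yx := linked_sym xy; apply/eqP; rewrite eqn_leq !distn_le//.
    exact/has_path_sym/distn_path.
  exact/has_path_sym/distn_path.
rewrite !distn_unlinked// => yx; exact/xy/linked_sym.
Qed.

Lemma distn_adj x y : adj x y -> distn x y <= 1.
Proof. by move=> xy; apply: distn_le; apply/has_pathP; exists [:: y]; rewrite /= xy. Qed.

Lemma geodesic x y : linked x y ->
  exists p, [/\ path (@adj G) x p, last x p = y &
    forall z, z \in x :: p ->
      [/\ linked x z, linked z y & distn x z + distn z y = distn x y]].
Proof.
move=> xy; have /has_pathP[p [xp py sp]] := distn_path xy.
exists p; split=> // z zp.
case/splitPl: zp xp py sp => p1 p2 <-.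
rewrite cat_path last_cat size_cat => /andP[xp1 zp2] py sp.
have h1 : has_path x (last x p1) (size p1) by apply/has_pathP; exists p1.
have h2 : has_path (last x p1) y (size p2) by apply/has_pathP; exists p2.
have l1 : linked x (last x p1) by exists (size p1).
have l2 : linked (last x p1) y by exists (size p2).
split=> //; apply/eqP; rewrite eqn_leq distn_triangle// andbT -sp.
by rewrite leq_add// distn_le.
Qed.

End Metric.

(** * Incidence and homology mod 2 *)

Section Incidence.
Variable M : square_surface.
Local Notation edge_of := (@edge_of M).
Local Notation vertex_of := (@vertex_of M).
Local Notation side_end := (@side_end M).

Lemma edge_of_mate s : edge_of (mate s) = edge_of s.
Proof. by rewrite /edge_of; apply/eqmodP; rewrite /= /same_edge mateK eqxx orbT. Qed.

Lemma edge_of_repr (e : edge M) : edge_of (repr e) = e.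
Proof. by rewrite /edge_of reprK. Qed.

Lemma eq_edge_of s t : edge_of s = edge_of t -> t = s \/ t = mate s.
Proof. by move=> /eqmodP /= /orP[] /eqP ->; [left|right]. Qed.

Lemma repr_edge_of s : repr (edge_of s) = s \/ repr (edge_of s) = mate s.
Proof. by apply: eq_edge_of; rewrite edge_of_repr. Qed.

Lemma vertex_of_glue x y : corner_glue x y -> vertex_of x = vertex_of y.
Proof. by move=> xy; apply/eqmodP => /=; exact: connect1. Qed.

Lemma vertex_of_mate s b : mate s != s ->
  vertex_of (side_end (mate s) (b (+) flip s)) = vertex_of (side_end s b).
Proof.
move=> ms; apply/esym/vertex_of_glue/existsP; exists s; apply/existsP; exists b.
by rewrite ms !eqxx.
Qed.

(** All corners on a gluing chain represent the same vertex, so invariance under the gluings at that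
    vertex suffices. Fixing a single [v] allows functions that are invariant only at the vertices of
    a path. *)
Lemma vertex_of_ind (T : Type) (h : corner M -> T) :
  forall v : vertex M,
  (forall s b, mate s != s -> vertex_of (side_end s b) = v ->
     h (side_end s b) = h (side_end (mate s) (b (+) flip s))) ->
  forall x y, vertex_of x = v -> vertex_of y = v -> h x = h y.
Proof.
move=> v hv x y xv yv.
have /eqmodP /= /connectP[p] : vertex_of x = vertex_of y by rewrite xv yv.
elim: p x xv => [|z p IH] x xv /=; first by move=> _ ->.
move=> /andP[xz pz] yE.
have zv : vertex_of z = v by rewrite -xv; exact/esym/vertex_of_glue.
rewrite -(IH z)//; move: xz => /existsP[s /existsP[b /and3P[ms /eqP xE /eqP ->]]].
by rewrite xE; apply: hv => //; rewrite -xE.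
Qed.

(** Independent of the chosen side only for symmetric [F], since a flipped gluing exchanges the
    ends. *)
Definition edge_fun (F : rel (vertex M)) (e : edge M) : bool :=
  F (vertex_of (side_end (repr e) false)) (vertex_of (side_end (repr e) true)).

Lemma edge_fun_side F s : symmetric F -> edge_fun F (edge_of s) =
  F (vertex_of (side_end s false)) (vertex_of (side_end s true)).
Proof.
move=> Fsym; rewrite /edge_fun; case: (repr_edge_of s) => -> //.
have [->//|ms] := eqVneq (mate s) s.
rewrite -(vertex_of_mate false ms) -(vertex_of_mate true ms).
by case: (flip s) => //=; exact: Fsym.
Qed.

Lemma edge_ends_side s : edge_ends (edge_of s) =
  [set vertex_of (side_end s false); vertex_of (side_end s true)].
Proof.
apply/setP => v; apply/bigcupP/idP => [[t /eqP /esym/eq_edge_of]|vs]; last by exists s.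
move=> [->//|->]; have [->//|ms] := eqVneq (mate s) s.
rewrite -(vertex_of_mate false ms) -(vertex_of_mate true ms).
by case: (flip s) => //=; rewrite setUC.
Qed.

Lemma edge_fun_ends F e x y : symmetric F -> edge_ends e = [set x; y] ->
  edge_fun F e = F x y.
Proof.
move=> Fsym; rewrite -[e]edge_of_repr edge_ends_side edge_fun_side//.
move: (vertex_of _) (vertex_of _) => b a ab.
have: a \in [set x; y] by rewrite -ab !inE eqxx.
have: b \in [set x; y] by rewrite -ab !inE eqxx orbT.
have: x \in [set a; b] by rewrite ab !inE eqxx.
have: y \in [set a; b] by rewrite ab !inE eqxx orbT.
rewrite !inE {ab}.
by do 4!(move=> /orP[]/eqP ?); subst.
Qed.

Definition coboundary (g : vertex M -> bool) : edge M -> bool :=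
  edge_fun (fun x y => g x (+) g y).

Lemma coboundary_side g s : coboundary g (edge_of s) =
  g (vertex_of (side_end s false)) (+) g (vertex_of (side_end s true)).
Proof. by apply: edge_fun_side => x y; exact: addbC. Qed.

Lemma coboundary_ends g e x y : edge_ends e = [set x; y] ->
  coboundary g e = g x (+) g y.
Proof. by apply: edge_fun_ends => ? ?; exact: addbC. Qed.

Lemma sum_sides (F : side M -> bool) :
  \big[addb/false]_s F s = \big[addb/false]_(e : edge M)
    (F (repr e) (+) (mate (repr e) != repr e) && F (mate (repr e))).
Proof.
rewrite (partition_big edge_of xpredT)//=; apply: eq_bigr => e _.
rewrite (bigD1 (repr e)) ?edge_of_repr//=; congr (_ (+) _).
have [me|me] := eqVneq (mate (repr e)) (repr e).
  apply: big1 => s /andP[/eqP se sr].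
  have := repr_edge_of s; rewrite se => -[re|re]; rewrite re ?mateK in me sr;
    by rewrite ?eqxx -?me ?eqxx in sr.
rewrite (bigD1 (mate (repr e))) ?edge_of_mate ?edge_of_repr ?eqxx//= big1 ?addbF//.
move=> s /andP[/andP[/eqP se sr] sm].
by have := repr_edge_of s; rewrite se => -[re|re]; rewrite re ?mateK ?eqxx in sr sm.
Qed.

(** A glued edge lies on two sides and cancels mod 2; an unpaired side is counted once. *)
Lemma mod2_stokes (F : edge M -> bool) :
  \big[addb/false]_(q : cell M) \big[addb/false]_(k < 4) F (edge_of (q, k)) =
  \big[addb/false]_(e in boundary_edges M) F e.
Proof.
rewrite pair_bigA /=.
under eq_bigr do rewrite -surjective_pairing.
rewrite sum_sides [RHS]big_mkcond; apply: eq_bigr => e _.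
rewrite edge_of_mate edge_of_repr.
have -> : (e \in boundary_edges M) = (mate (repr e) == repr e).
  apply/imsetP/idP => [[s]|me]; last by exists (repr e); rewrite ?edge_of_repr.
  rewrite inE => /eqP ms ->; case: (repr_edge_of s) => ->; rewrite ?ms ?mateK ?eqxx//.
by case: eqP => //=; rewrite ?addbF// addbb.
Qed.

End Incidence.

(** * First homology mod 2, by duality with cohomology *)

Section Homology.
Variable M : square_surface.
Local Notation edge_of := (@edge_of M).
Hypothesis H1 : forall c : edge M -> bool,
  (forall q, \big[addb/false]_(k < 4) c (edge_of (q, k)) = false) ->
  exists g, forall e, c e = coboundary g e.

(** The coefficient of [e] in the mod 2 boundary of [q]; a glued edge with both sides on [q] gets
    0. *)
Definition incidence (q : cell M) (e : edge M) : bool :=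
  ((repr e).1 == q) (+) ((mate (repr e) != repr e) && ((mate (repr e)).1 == q)).

Lemma cell_sum (q : cell M) (c : edge M -> bool) :
  \big[addb/false]_(k < 4) c (edge_of (q, k)) =
  \big[addb/false]_e (incidence q e && c e).
Proof.
transitivity (\big[addb/false]_(s : side M) ((s.1 == q) && c (edge_of s))).
  transitivity (\big[addb/false]_q' \big[addb/false]_(k < 4) ((q' == q) && c (edge_of (q', k)))).
    rewrite [RHS](bigD1 q)//= eqxx /= [X in _ (+) X]big1 ?addbF// => q' /negbTE ->.
    by rewrite big1.
  by rewrite pair_bigA; apply: eq_bigr => -[].
rewrite sum_sides; apply: eq_bigr => e _.
by rewrite edge_of_mate edge_of_repr andb_addl andbA.
Qed.

(** Linear duality over the field [bool]: the columns of the cokernel of the boundary matrix [B] are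
    cocycles, hence coboundaries, and [z] pairs to zero with those, so [z] lies in the row space of
    [B]. The coefficients [S] form a set of squares with boundary [z]. *)
Lemma cycle_is_boundary (z : edge M -> bool) :
  (forall g, \big[addb/false]_e (z e && coboundary g e) = false) ->
  exists S : cell M -> bool, forall s,
    z (edge_of s) = S s.1 (+) ((mate s != s) && S (mate s).1).
Proof.
move=> z0.
pose B : 'M[bool]_(#|cell M|, #|edge M|) :=
  (\matrix_(i, j) incidence (enum_val i) (enum_val j))%R.
pose zr : 'rV[bool]_#|edge M| := (\row_j z (enum_val j))%R.
have : (zr <= B)%MS.
  rewrite submxE; apply/eqP/matrixP => i0 j; rewrite !mxE.
  pose c e := cokermx B (enum_rank e) j.
  have sumE (F : edge M -> bool) : \big[addb/false]_e F e = (\sum_(k < #|edge M|) F (enum_val k))%R.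
    by rewrite (reindex _ (onW_bij _ (@enum_val_bij (edge M)))).
  have cE k : cokermx B k j = c (enum_val k) by rewrite /c enum_valK.
  have [q|g gE] := H1 (c := c).
    have /matrixP/(_ (enum_rank q) j) := mulmx_coker B.
    rewrite !mxE => e; rewrite cell_sum sumE -[RHS]e; apply: eq_bigr => k _.
    by rewrite mxE enum_rankK cE.
  rewrite -[RHS](z0 g) sumE; apply: eq_bigr => k _.
  by rewrite mxE cE gE.
case/submxP => D zE.
pose S q := D ord0 (enum_rank q).
have SE e : z e = S (repr e).1 (+) ((mate (repr e) != repr e) && S (mate (repr e)).1).
  have /matrixP/(_ ord0 (enum_rank e)) := zE; rewrite !mxE enum_rankK => ->.
  transitivity (\big[addb/false]_(q : cell M) (S q && incidence q e)).
    rewrite (reindex _ (onW_bij _ (@enum_val_bij (cell M))))/=.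
    by apply: eq_bigr => k _; rewrite mxE /S enum_valK enum_rankK.
  have pick1 q0 : \big[addb/false]_(q : cell M) (S q && (q0 == q)) = S q0.
    rewrite (bigD1 q0)//= eqxx andbT big1 ?addbF// => q.
    by rewrite eq_sym => /negbTE ->; rewrite andbF.
  rewrite /incidence; under eq_bigr do rewrite andb_addr.
  rewrite big_split /= pick1; congr (_ (+) _).
  case: (_ != _) => /=; first exact: pick1.
  by apply: big1 => q _; rewrite andbF.
exists S => s; rewrite SE; case: (repr_edge_of s) => -> //.
rewrite mateK [s == _]eq_sym; case: (eqVneq (mate s) s) => [->//|_] /=; exact: addbC.
Qed.

End Homology.

(** * Mod 2 cocycles on a disk *)

Section DiskCohomology.
Import boolp classical_sets functions.
Local Open Scope ring_scope.
Local Open Scope classical_set_scope.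

(** * Sections of rank one matrix fields *)

Lemma sum_continuous (R : realType) (T : topologicalType) (I : finType)
    (f : I -> T -> R) :
  (forall i, continuous (f i)) -> continuous (fun x => \sum_i f i x).
Proof.
by move=> fc; apply: (@continuous_big R I _ 0 xpredT) => //; exact: add_continuous.
Qed.

(** Continuity gives such a [d] locally; compactness of the square, in its near-covering form, makes
    it uniform. *)
Lemma uniformly_neq0 (R : realType) (F : (R * R) * (R * R) -> R) :
  continuous F -> (forall p, F (p, p) != 0) ->
  exists2 d : R, 0 < d & forall p q : R * R, `|p.1| <= 1 -> `|p.2| <= 1 ->
    `|q.1 - p.1| < d -> `|q.2 - p.2| < d -> F (p, q) != 0.
Proof.
move=> Fc F0.
pose K := (`[(-1 : R), 1] `*` `[(-1 : R), 1])%classic.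
have Kc : compact K by apply: compact_setX; exact: segment_compact.
have /(_ R (0 : R)^'+
  (fun d p => forall q : R * R, `|q.1 - p.1| < d -> `|q.2 - p.2| < d -> F (p, q) != 0)) :=
  (compact_near_coveringP K).1 Kc.
case.
  move=> p _.
  have /(_ (p, p)) := Fc.
  move=> /cvgrPdist_lt /(_ `|F (p, p)|).
  rewrite normr_gt0 F0 => /(_ isT).
  case=> -[/= A B] [/nbhs_ballP[a a0 aA] /nbhs_ballP[b b0 bB]] AB.
  (* A point within [b / 2] of [p'], itself within [b / 2] of [p], stays in the [b]-ball around
     [p]. *)
  exists (ball p (Num.min a (b / 2)), [set d | d < b / 2]).
    split => /=; last by apply: nbhs_right_lt; rewrite divr_gt0.
    by apply: nbhsx_ballx; rewrite lt_min a0 divr_gt0.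
  move=> [p' d] [/= [p'1 p'2] db] q q1 q2.
  have /AB /= : (A `*` B) (p', q).
    split => /=.
      by apply: aA; split; [apply: le_ball p'1|apply: le_ball p'2]; rewrite ge_min lexx.
    apply: bB; split; rewrite /ball /=.
      have : ball p.1 (b / 2) p'.1 by apply: le_ball p'1; rewrite ge_min lexx orbT.
      rewrite -ball_normE /ball_ /= => h.
      rewrite (splitr b) distrC.
      by rewrite (le_lt_trans (ler_distD p'.1 _ _))// ltrD// ?(lt_trans q1) // distrC.
    have : ball p.2 (b / 2) p'.2 by apply: le_ball p'2; rewrite ge_min lexx orbT.
    rewrite -ball_normE /ball_ /= => h.
    rewrite (splitr b) distrC.
    by rewrite (le_lt_trans (ler_distD p'.2 _ _))// ltrD// ?(lt_trans q2) // distrC.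
  by apply: contraTneq => ->; rewrite subr0 ltxx.
move=> e /= e0 eK; exists (e / 2); first by rewrite divr_gt0.
move=> p q p1 p2; apply: (eK (e / 2)) => /=.
- by rewrite sub0r normrN gtr0_norm ?divr_gt0// ltr_pdivrMr// ltr_pMr// ltr1n.
- by rewrite divr_gt0.
- by split; rewrite /= in_itv /= -ler_norml.
Qed.

Lemma pair_continuous (T U V : topologicalType) (f : T -> U) (g : T -> V) :
  continuous f -> continuous g -> continuous (fun x => (f x, g x)).
Proof. by move=> fc gc x; apply: cvg_pair; [exact: fc|exact: gc]. Qed.

Lemma fst_continuous (U V : topologicalType) : continuous (@fst U V).
Proof. by move=> [x y]; exact: cvg_fst. Qed.

Lemma snd_continuous (U V : topologicalType) : continuous (@snd U V).
Proof. by move=> [x y]; exact: cvg_snd. Qed.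

Lemma mulr_continuous (R : realType) (T : topologicalType) (f g : T -> R) :
  continuous f -> continuous g -> continuous (fun x => f x * g x).
Proof. by move=> fc gc x; apply: continuousM; [exact: fc|exact: gc]. Qed.

Lemma comp_continuous (T U V : topologicalType) (f : T -> U) (g : U -> V) :
  continuous f -> continuous g -> continuous (fun x => g (f x)).
Proof. by move=> fc gc x; apply: continuous_comp; [exact: fc|exact: gc]. Qed.

(** For [P p = u u^T] and [P q = v v^T], the trace [F (p, q)] of the product is the square of the
    inner product of [u] and [v]. So for [q] near [p], [P q] sends [u] to a nonzero multiple of [v].
    Iterating along the points [s k p] stays continuous, as it only takes sums and products of
    entries of [P]. *)
Lemma rank_one_section (R : realType) (I : finType) (P : R * R -> I -> I -> R) :
  (forall i j, continuous (fun p => P p i j)) ->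
  (forall p, exists2 u : I -> R, (exists i, u i != 0) &
                                 forall i j, P p i j = u i * u j) ->
  exists2 W : R * R -> I -> R, forall i, continuous (W^~ i) &
    forall p, `|p.1| <= 1 -> `|p.2| <= 1 ->
    forall u, (forall i j, P p i j = u i * u j) ->
    exists2 k, k != 0 & forall i, W p i = k * u i.
Proof.
move=> Pc P1.
pose F (z : (R * R) * (R * R)) := \sum_i \sum_j P z.1 i j * P z.2 i j.
have FE p q u v : (forall i j, P p i j = u i * u j) ->
    (forall i j, P q i j = v i * v j) -> F (p, q) = (\sum_i u i * v i) ^+ 2.
  move=> Pu Pv; rewrite /F expr2 mulr_suml; apply: eq_bigr => i _.
  rewrite mulr_sumr; apply: eq_bigr => j _.
  by rewrite Pu Pv /= mulrACA.
have Fc : continuous F.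
  apply: sum_continuous => i; apply: sum_continuous => j.
  apply: mulr_continuous.
  - by apply: (comp_continuous (@fst_continuous _ _) (Pc i j)).
  - by apply: (comp_continuous (@snd_continuous _ _) (Pc i j)).
have F0 p : F (p, p) != 0.
  have [u [i ui] Pu] := P1 p.
  rewrite (FE p p u u) // expf_neq0// psumr_neq0.
    by apply/hasP; exists i; rewrite ?mem_index_enum//= -expr2 exprn_even_gt0.
  by move=> j _; rewrite -expr2 sqr_ge0.
have [d d0 Fd] := uniformly_neq0 Fc F0.
have [N Nd] : exists N : nat, N.+1%:R^-1 < d.
  have [N Nd] := ltr_add_invr d0; exists N; by rewrite add0r in Nd.
have [u0 [i0 u0i0] Pu0] := P1 (0, 0).
pose s (k : nat) (p : R * R) : R * R := (k%:R / N.+1%:R * p.1, k%:R / N.+1%:R * p.2).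
pose W := fix W k (p : R * R) (i : I) : R :=
  if k is k'.+1 then \sum_j P (s k p) i j * W k' p j else u0 i.
have sc k : continuous (s k).
  apply: pair_continuous; apply: mulr_continuous.
  - exact: cst_continuous.
  - exact: fst_continuous.
  - exact: cst_continuous.
  - exact: snd_continuous.
have Wc k i : continuous (fun p => W k p i).
  elim: k i => [|k IH] i; first exact: cst_continuous.
  apply: sum_continuous => j; apply: mulr_continuous; last exact: IH.
  exact: (comp_continuous (sc k.+1) (Pc i j)).
have key p : `|p.1| <= 1 -> `|p.2| <= 1 -> forall k, (k <= N.+1)%N ->
    forall u, (forall i j, P (s k p) i j = u i * u j) ->
    exists2 l, l != 0 & forall i, W k p i = l * u i.
  move=> p1 p2; elim=> [|k IH] kN u Pu.
    have s0 : s 0 p = (0, 0) by rewrite /s !mul0r.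
    rewrite s0 in Pu.
    have uu0 i : u i0 * u i = u0 i0 * u0 i by rewrite -Pu -Pu0.
    have ui0 : u i0 != 0.
      have := uu0 i0; apply: contra_eq_neq => ->.
      by rewrite mul0r eq_sym mulf_neq0.
    exists (u i0 / u0 i0); first by rewrite mulf_neq0// invr_eq0.
    by move=> i /=; rewrite mulrAC uu0 mulrAC divff// mul1r.
  have [v _ Pv] := P1 (s k p).
  have [l l0 Wl] := IH (ltnW kN) v Pv.
  have uv0 : \sum_i u i * v i != 0.
    have : F (s k p, s k.+1 p) != 0.
      have k1 : `|k%:R / N.+1%:R : R| <= 1.
        by rewrite ger0_norm ?divr_ge0// ler_pdivrMr// mul1r ler_nat ltnW.
      have dk x : `|x| <= 1 -> `|k.+1%:R / N.+1%:R * x - k%:R / N.+1%:R * x| < d.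
        move=> x1; rewrite -mulrBl -mulrBl -natrB// subSnn mul1r.
        rewrite normrM ger0_norm ?invr_ge0//.
        by apply: le_lt_trans Nd; rewrite ler_piMr// invr_ge0.
      by apply: Fd; rewrite /= ?[`|k%:R / _ * _|]normrM ?mulr_ile1//; apply: dk.
    rewrite (FE _ _ v u)// sqrf_eq0; apply: contraNneq => e0.
    by under eq_bigr do rewrite mulrC; rewrite e0.
  exists (l * \sum_i u i * v i); first exact: mulf_neq0.
  move=> i /=; rewrite mulr_sumr mulr_suml; apply: eq_bigr => j _.
  by rewrite Pu Wl mulrACA (mulrC (u i)) mulrAC.
exists (W N.+1) => // p p1 p2 u Pu; apply: key => //.
suff -> : s N.+1 p = p by [].
by rewrite /s divff ?pnatr_eq0// !mul1r -surjective_pairing.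
Qed.

(** Dividing by the square of the norm is enough to land in the disk, and
    avoids square roots. *)
Definition disk_clamp (R : realType) (p : R * R) : R * R :=
  let m := Num.max 1 (p.1 ^+ 2 + p.2 ^+ 2) in (p.1 / m, p.2 / m).

Lemma disk_clampP (R : realType) (p : R * R) :
  (disk_clamp p).1 ^+ 2 + (disk_clamp p).2 ^+ 2 <= 1.
Proof.
rewrite /disk_clamp /=; set m := Num.max _ _.
have m1 : 1 <= m by rewrite le_max lexx.
have m0 : 0 < m by exact: lt_le_trans m1.
have mp : p.1 ^+ 2 + p.2 ^+ 2 <= m by rewrite le_max lexx orbT.
rewrite !expr_div_n -mulrDl ler_pdivrMr ?exprn_gt0// mul1r (le_trans mp)//.
by rewrite expr2 ler_peMl// ltW.
Qed.

Definition disk_retract (R : realType) (p : R * R) : closed_disk R :=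
  exist _ (disk_clamp p) (mem_set (disk_clampP p)).

Lemma disk_retract_continuous (R : realType) : continuous (@disk_retract R).
Proof.
apply: continuous_comp_initial.
have -> : set_val \o @disk_retract R = @disk_clamp R by apply/funext => p; rewrite /= set_valE.
pose m (p : R * R) : R := Num.max 1 (p.1 ^+ 2 + p.2 ^+ 2).
have sqc (f : R * R -> R) : continuous f -> continuous (fun p => f p ^+ 2).
  by move=> fc; exact: (mulr_continuous fc fc).
have mc : continuous m.
  refine (@comp_continuous _ (R * R)%type R
    (fun p : R * R => (1, p.1 ^+ 2 + p.2 ^+ 2)) (fun z : R * R => Num.max z.1 z.2)
    _ (@max_continuous _ R)).
  apply: pair_continuous; first exact: cst_continuous.
  by move=> p; apply: cvgD; apply: sqc; [exact: fst_continuous|exact: snd_continuous].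
have ic : continuous (fun p => (m p)^-1).
  move=> p; apply: continuousV; last exact: mc.
  by rewrite gt_eqF// (lt_le_trans ltr01)// le_max lexx.
apply: pair_continuous; apply: mulr_continuous => //.
- exact: fst_continuous.
- exact: snd_continuous.
Qed.

Lemma disk_retractK (R : realType) : cancel (@set_val _ _) (@disk_retract R).
Proof.
move=> x; apply/val_inj => /=; rewrite set_valE.
case: x => p /= /[dup] /set_mem /= p1 _.
by rewrite /disk_clamp max_l// invr1 !mulr1 -surjective_pairing.
Qed.

(** The retraction extends the transported field from the disk to the plane, and the disk lies in
    the square covered by [rank_one_section]. *)
Lemma disk_rank_one_section (R : realType) (X : topologicalType) (I : finType)
    (P : X -> I -> I -> R) :
  homeomorphic X (closed_disk R) ->
  (forall i j, continuous (fun x => P x i j)) ->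
  (forall x, exists2 u : I -> R, (exists i, u i != 0) &
                                 forall i j, P x i j = u i * u j) ->
  exists2 W : X -> I -> R, forall i, continuous (W^~ i) &
    forall x u, (forall i j, P x i j = u i * u j) ->
    exists2 k, k != 0 & forall i, W x i = k * u i.
Proof.
move=> [f [g [fK gK fc gc]]] Pc P1.
pose Q p i j := P (g (disk_retract p)) i j.
have [|p|W Wc WP] := @rank_one_section R I Q.
- move=> i j; exact: (comp_continuous (@disk_retract_continuous R)
                                    (comp_continuous gc (Pc i j))).
- exact: P1.
exists (fun x => W (set_val (f x))).
  move=> i; apply: (comp_continuous (f := fun x => set_val (f x)) _ (Wc i)).
  exact: (comp_continuous fc (@initial_continuous _ _ _)).
have sq1 (a b : R) : a ^+ 2 + b ^+ 2 <= 1 -> `|a| <= 1.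
  move=> ab; rewrite -(expr_le1 (n := 2))// -normrX ger0_norm ?sqr_ge0//.
  by apply: le_trans ab; rewrite lerDl sqr_ge0.
move=> x u Pu.
have : (set_val (f x)).1 ^+ 2 + (set_val (f x)).2 ^+ 2 <= 1.
  exact: (set_valP (f x)).
move=> /[dup] /sq1 h1; rewrite addrC => /sq1 h2.
by apply: WP => // i j; rewrite /Q disk_retractK fK Pu.
Qed.

Lemma neq0_constant_sign (R : realType) (f : R * R -> R) :
  continuous f -> (forall p, f p != 0) -> forall p q, (f p < 0) = (f q < 0).
Proof.
move=> fc f0 p q.
wlog suff : p q / f p < 0 -> f q < 0.
  by move=> h; apply/idP/idP; exact: h.
move=> fp; rewrite ltNge; apply/negP => fq.
pose s (t : R) : R * R := (p.1 + t * (q.1 - p.1), p.2 + t * (q.2 - p.2)).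
have ac (a b : R) : continuous (fun t : R => a + t * b).
  by move=> t; apply: cvgD; [exact: cvg_cst|apply: cvgMl; exact: cvg_id].
have gc : continuous (fun t => f (s t)).
  by apply: (comp_continuous (f := s) _ fc); exact: pair_continuous.
have s0 : s 0 = p by rewrite /s !mul0r !addr0 -surjective_pairing.
have s1 : s 1 = q by rewrite /s !mul1r !subrKC -surjective_pairing.
have [||t _ /eqP] := @IVT R (fun t => f (s t)) 0 1 0 ler01.
- exact: continuous_subspaceT.
- by rewrite s0 s1 ge_min le_max (ltW fp) fq orbT.
- by rewrite (negbTE (f0 _)).
Qed.

(** * Functions on the unit square *)

Definition square_clamp_fun (R : realType) (p : R * R) : R * R :=
  (Num.min 1 (Num.max 0 p.1), Num.min 1 (Num.max 0 p.2)).

Lemma square_clampP (R : realType) (p : R * R) : unit_square (square_clamp_fun p).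
Proof. by split; rewrite /= le_min ge_min ler01 le_max !lexx. Qed.

(** Turns functions on a cell into functions on the plane, where [neq0_constant_sign] applies. *)
Definition square_clamp (R : realType) (p : R * R) : set_type (@unit_square R) :=
  exist _ (square_clamp_fun p) (mem_set (square_clampP p)).

Lemma square_clamp_id (R : realType) (p : R * R) :
  unit_square p -> set_val (square_clamp p) = p.
Proof.
case: p => a b [/= /andP[a0 a1] /andP[b0 b1]].
by rewrite set_valE /= /square_clamp_fun /= !max_r// !min_r.
Qed.

Lemma square_clamp_continuous (R : realType) : continuous (@square_clamp R).
Proof.
apply: continuous_comp_initial.
have -> : set_val \o @square_clamp R = @square_clamp_fun R.
  by apply/funext => p; rewrite /= set_valE.
have cl (f : R * R -> R) : continuous f ->
    continuous (fun p => Num.min 1 (Num.max 0 (f p))).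
  move=> fc; refine (@comp_continuous _ (R * R)%type R
    (fun p : R * R => (1, Num.max 0 (f p))) (fun z : R * R => Num.min z.1 z.2)
    _ (@min_continuous _ R)).
  apply: pair_continuous; first exact: cst_continuous.
  refine (@comp_continuous _ (R * R)%type R
    (fun p : R * R => (0, f p)) (fun z : R * R => Num.max z.1 z.2)
    _ (@max_continuous _ R)).
  by apply: pair_continuous => //; exact: cst_continuous.
apply: pair_continuous; apply: cl; [exact: fst_continuous|exact: snd_continuous].
Qed.

(** The bilinear interpolation functions of the four corners. *)
Definition hat (R : realType) (k : 'I_4) (p : R * R) : R :=
  match val k with
  | 0%N => (1 - p.1) * (1 - p.2)
  | 1%N => p.1 * (1 - p.2)
  | 2%N => p.1 * p.2
  | _ => (1 - p.1) * p.2
  end.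

Lemma hat_continuous (R : realType) k : continuous (@hat R k).
Proof.
have f1 := @fst_continuous R R; have f2 := @snd_continuous R R.
have oc (f : R * R -> R) : continuous f -> continuous (fun p => 1 - f p).
  by move=> fc p; apply: cvgB; [exact: cvg_cst|exact: fc].
by case: k => [[|[|[|[|//]]]] ?]; rewrite /hat /=; apply: mulr_continuous => //;
  exact: oc.
Qed.

Lemma hat_side (R : realType) (k i : 'I_4) (t : R) :
  hat k (side_param i t) = (k == i)%:R * (1 - t) + (k == ordS i)%:R * t.
Proof.
by case: k i => [[|[|[|[|//]]]] ?] [[|[|[|[|//]]]] ?];
   rewrite /hat /side_param -!val_eqE /=; ring.
Qed.

Lemma ordS_neq (i : 'I_4) : (ordS i == i) = false.
Proof. by case: i => [[|[|[|[|//]]]] ?]. Qed.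

Lemma sum_hat_side (R : realType) (F : 'I_4 -> R) i (t : R) :
  \sum_k F k * hat k (side_param i t) = F i * (1 - t) + F (ordS i) * t.
Proof.
rewrite (bigD1 i)//= (bigD1 (ordS i)) ?ordS_neq//= big1 ?addr0.
  by rewrite !hat_side !eqxx ordS_neq [i == _]eq_sym ordS_neq !mul1r !mul0r addr0 add0r.
by move=> k /andP[/negbTE ki /negbTE kSi]; rewrite hat_side ki kSi !mul0r addr0 mulr0.
Qed.

(** The product of two consecutive hats is a bump on side [k] that vanishes on the three other
    sides. *)
Lemma sum_hat2_side (R : realType) (F : 'I_4 -> R) i (t : R) :
  \sum_k F k * (hat k (side_param i t) * hat (ordS k) (side_param i t)) =
  F i * ((1 - t) * t).
Proof.
rewrite (bigD1 i)//= big1 ?addr0.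
  by rewrite !hat_side !eqxx ordS_neq [i == _]eq_sym ordS_neq !mul1r !mul0r addr0 add0r.
move=> k ki; suff -> : hat k (side_param i t) * hat (ordS k) (side_param i t) = 0.
  by rewrite mulr0.
rewrite !hat_side; move: ki; rewrite -!val_eqE.
by case: k i => [[|[|[|[|//]]]] ?] [[|[|[|[|//]]]] ?] //= _; ring.
Qed.

(** The product is [x (1 - x) y (1 - y)], which vanishes only on the lines through the sides; [t]
    may lie outside [[0, 1]]. *)
Lemma hat_product_eq0 (R : realType) (p : R * R) :
  hat ord0 p * hat (@Ordinal 4 2 isT) p = 0 ->
  exists i t, p = side_param i t.
Proof.
case: p => x y; rewrite /hat /= => /eqP; rewrite !mulf_eq0 !subr_eq0 /=.
case/or3P => [/orP[]/eqP <-|/eqP ->|/eqP ->].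
- by exists (@Ordinal 4 1 isT), y.
- by exists (@Ordinal 4 2 isT), (1 - x); rewrite /side_param /= subKr.
- by exists (@Ordinal 4 3 isT), (1 - y); rewrite /side_param /= subKr.
- by exists (@Ordinal 4 0 isT), x.
Qed.

Lemma side_param_unit_square (R : realType) i (t : R) : 0 <= t <= 1 ->
  unit_square (side_param i t).
Proof.
by case: i => [[|[|[|[|//]]]] ?] /andP[t0 t1]; split; rewrite /side_param /=;
  apply/andP; split; lra.
Qed.

(** * The line bundle of a cocycle *)

Section Potential.
Variables (M : square_surface) (c : side M -> bool).
Hypothesis c_mate : forall s, c (mate s) = c s.
Hypothesis c_cell : forall q, \big[addb/false]_(k < 4) c (q, k) = false.

Local Notation o k := (@Ordinal 4 k isT).

Local Notation edge_of := (@edge_of M).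
Local Notation vertex_of := (@vertex_of M).
Local Notation side_end := (@side_end M).

(** A primitive of [c] around each square, normalised at corner 0; corner 3 is reached backwards
    along side 3. *)
Definition local_potential (x : corner M) : bool :=
  match val x.2 with
  | 0 => false
  | 1 => c (x.1, o 0)
  | 2 => c (x.1, o 0) (+) c (x.1, o 1)
  | _ => c (x.1, o 3)
  end.
Local Notation pot := local_potential.

(** Sides 0, 1 and 3 hold by construction, and [c_cell] closes the circuit at side 2. *)
Lemma local_potential_side s :
  pot (side_end s false) (+) pot (side_end s true) = c s.
Proof.
case: s => q k; have := c_cell q; rewrite !big_ord_recl big_ord0 /pot /=.
have -> : ord0 = o 0 by exact/val_inj.
have -> : lift (o 0) ord0 = o 1 by exact/val_inj.
have -> : lift (o 0) (lift ord0 ord0) = o 2 by exact/val_inj.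
have -> : lift (o 0) (lift ord0 (lift ord0 ord0)) = o 3 by exact/val_inj.
case: k => [[|[|[|[|//]]]] lt_k] /=.
- by rewrite (_ : Ordinal lt_k = o 0)//; exact/val_inj.
- by rewrite (_ : Ordinal lt_k = o 1) ?addKb//; exact/val_inj.
- rewrite (_ : Ordinal lt_k = o 2); last exact/val_inj.
  by do 4!case: (c _).
- by rewrite (_ : Ordinal lt_k = o 3) ?addbF//; exact/val_inj.
Qed.

(** The end of a side at which the sign of its edge coordinate is read off;
    both sides of a glued pair select the same end of their common edge. *)
Definition edge_start (s : side M) : bool :=
  if s == repr (edge_of s) then false else flip s.

Lemma edge_start_mate s : mate s != s ->
  edge_start (mate s) = edge_start s (+) flip s.
Proof.
move=> ms; rewrite /edge_start edge_of_mate.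
case: (repr_edge_of s) => ->; rewrite eqxx ?(negbTE ms) ?flip_mate //.
by rewrite eq_sym (negbTE ms) addbb.
Qed.

Variable R : realType.

Definition sgb (b : bool) : R := (-1) ^+ b.

Definition sheet_index : finType := (cell M + edge M + vertex M)%type.

(** A spanning vector of the fibre over a point of a square.  The vertex
    coordinates alone would define the bundle, but they may cancel where
    several corners of a square are the same vertex; the edge coordinates are
    nonzero inside the edges, and the cell coordinates inside the squares. *)
Definition sheet_vector (q : cell M) (p : R * R) (i : sheet_index) : R :=
  match i with
  | inl (inl q') => (q == q')%:R * (hat ord0 p * hat (@Ordinal 4 2 isT) p)
  | inl (inr e) =>
      \sum_k (edge_of (q, k) == e)%:R * sgb (pot (side_end (q, k) (edge_start (q, k))))
             * (hat k p * hat (ordS k) p)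
  | inr v => \sum_k (vertex_of (q, k) == v)%:R * sgb (pot (q, k)) * hat k p
  end.

Lemma sheet_vector_continuous q i : continuous (fun p => sheet_vector q p i).
Proof.
case: i => [[q'|e]|v]; rewrite /sheet_vector.
- apply: mulr_continuous; first exact: cst_continuous.
  by apply: mulr_continuous; exact: hat_continuous.
- apply: sum_continuous => k; apply: mulr_continuous; first exact: cst_continuous.
  by apply: mulr_continuous; exact: hat_continuous.
- apply: sum_continuous => k; apply: mulr_continuous; first exact: cst_continuous.
  exact: hat_continuous.
Qed.

Lemma sheet_vector_side (s : side M) (t : R) i :
  sheet_vector s.1 (side_param s.2 t) i =
  match i with
  | inl (inl _) => 0
  | inl (inr e) => (edge_of s == e)%:R * sgb (pot (side_end s (edge_start s))) * ((1 - t) * t)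
  | inr v =>
      (vertex_of (side_end s false) == v)%:R * sgb (pot (side_end s false)) * (1 - t)
    + (vertex_of (side_end s true) == v)%:R * sgb (pot (side_end s true)) * t
  end.
Proof.
case: s => q k; case: i => [[q'|e]|v] /=.
- rewrite !hat_side; case: k => [[|[|[|[|//]]]] ?]; rewrite -!val_eqE /=; ring.
- by rewrite sum_hat2_side.
- by rewrite sum_hat_side.
Qed.

(** The sign is the mismatch of the two local potentials at an end of the edge. It is the same at
    both ends ([tauE]), because both potentials change by the same value of [c] along the edge. *)
Lemma sheet_vector_mate (s : side M) (b : bool) (t : R) i : mate s != s ->
  sheet_vector s.1 (side_param s.2 t) i =
  sgb (pot (side_end s b) (+) pot (side_end (mate s) (b (+) flip s))) *
  sheet_vector (mate s).1 (side_param (mate s).2 (if flip s then 1 - t else t)) i.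
Proof.
move=> ms.
have tauE b' : pot (side_end s b) (+) pot (side_end (mate s) (b (+) flip s)) =
  pot (side_end s b') (+) pot (side_end (mate s) (b' (+) flip s)).
  have /= := local_potential_side (mate s); rewrite c_mate -local_potential_side.
  case: b b' (flip s) => [] [] [] //=; do 4!case: (pot _) => //.
have sgbM x y : sgb (x (+) y) = sgb x * sgb y.
  by rewrite /sgb; case: x y => [] []; rewrite /= ?expr0 ?expr1; ring.
have sgbb x : sgb x * sgb x = 1 by rewrite -sgbM addbb /sgb expr0.
rewrite !sheet_vector_side; case: i => [[q'|e]|v].
- by rewrite mulr0.
- rewrite edge_of_mate (tauE (edge_start s)) -edge_start_mate// sgbM.
  (* The edge bump does not see the direction of the parametrisation. *)
  have -> : (1 - (if flip s then 1 - t else t)) * (if flip s then 1 - t else t) =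
     (1 - t) * t by case: ifP => _; ring.
  set x := sgb _; set y := sgb _; have := sgbb (pot (side_end (mate s) (edge_start (mate s)))).
  rewrite -/y => yy; transitivity ((edge_of s == e)%:R * x * ((1 - t) * t) * (y * y)); last by ring.
  by rewrite yy mulr1.
- have := tauE true; rewrite (tauE false).
  have := vertex_of_mate false ms; have := vertex_of_mate true ms.
  have := sgbb (pot (side_end (mate s) false)).
  have := sgbb (pot (side_end (mate s) true)).
  case: (flip s) => /= y1 y0 -> -> tau1.
  + rewrite [RHS]mulrDr {1}tau1 !sgbM.
    set a0 : R := (_ == _)%:R; set a1 : R := (_ == _)%:R.
    set x0 := sgb (pot (side_end s false)); set x1 := sgb (pot (side_end s true)).
    move: y0 y1; set z0 := sgb _; set z1 := sgb _ => y0 y1.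
    transitivity (a0 * x0 * (1 - t) * (z1 * z1) + a1 * x1 * t * (z0 * z0)); last by ring.
    by rewrite y0 y1 !mulr1.
  + rewrite [RHS]mulrDr {2}tau1 !sgbM.
    set a0 : R := (_ == _)%:R; set a1 : R := (_ == _)%:R.
    set x0 := sgb (pot (side_end s false)); set x1 := sgb (pot (side_end s true)).
    move: y0 y1; set z0 := sgb _; set z1 := sgb _ => y0 y1.
    transitivity (a0 * x0 * (1 - t) * (z0 * z0) + a1 * x1 * t * (z1 * z1)); last by ring.
    by rewrite y0 y1 !mulr1.
Qed.

(** Off the side lines the cell coordinate is nonzero. At a corner one term of the vertex coordinate
    survives, so nothing cancels; elsewhere on a side line the edge coordinate is nonzero. *)
Lemma sheet_vector_neq0 q (p : R * R) : exists i, sheet_vector q p i != 0.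
Proof.
have sgb0 b : sgb b != 0 by rewrite /sgb signr_eq0.
have [p0|p0] := eqVneq (hat ord0 p * hat (o 2) p) 0; last first.
  by exists (inl (inl q)); rewrite /= eqxx mul1r.
have [k [t ->]] := hat_product_eq0 p0.
have sE t' i := @sheet_vector_side (q, k) t' i; rewrite /= in sE.
have [->|t0] := eqVneq t 0.
  exists (inr (vertex_of (side_end (q, k) false))); rewrite sE.
  by rewrite eqxx subr0 mul1r mulr1 mulr0 addr0.
have [->|t1] := eqVneq t 1.
  exists (inr (vertex_of (side_end (q, k) true))); rewrite sE.
  by rewrite eqxx subrr !mul1r mulr1 mulr0 add0r.
exists (inl (inr (edge_of (q, k)))); rewrite sE eqxx mul1r.
by rewrite !mulf_neq0// subr_eq0 eq_sym.
Qed.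

Local Notation sq := (squares R M).
Local Notation X := (surface_space R M).
Local Notation proj := (\pi_X%qT : sq -> X).

Definition sheet (z : sq) (i : sheet_index) : R :=
  sheet_vector (tag z) (set_val (tagged z)) i.

Lemma sheet_continuous i : continuous (fun z => sheet z i).
Proof.
pose F q (w : set_type (@unit_square R)) := sheet_vector q (set_val w) i.
suff Fc q : continuous (F q) by move=> -[q w]; move=> U nU; exact: (Fc q w U nU).
exact: (comp_continuous (@initial_continuous _ _ _) (@sheet_vector_continuous q i)).
Qed.

Lemma sheet_glue z z' : proj z = proj z' ->
  exists b, forall i, sheet z i = sgb b * sheet z' i.
Proof.
move=> /eqmodP /= /asboolP; elim => {z z'} [x y|x|x y _ [b bE]|x y z _ [b bE] _ [b' b'E]].
- move=> [s [t [t01 ms [xq xp] [yq yp]]]].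
  exists (pot (side_end s false) (+) pot (side_end (mate s) (false (+) flip s))) => i.
  by rewrite /sheet !set_valE xq xp yq yp; exact: sheet_vector_mate.
- by exists false => i; rewrite /sgb expr0 mul1r.
- by exists b => i; rewrite bE mulrA /sgb -expr2 sqrr_sign mul1r.
- exists (b (+) b') => i; rewrite bE b'E mulrA; congr (_ * _).
  by rewrite /sgb signr_addb.
Qed.

(** At glued points the vectors [sheet] agree only up to sign, but their products descend to the
    surface. Comparing a global section with [sheet] gives each square a sign, which corrects the
    local potentials to a global one. *)
Theorem cocycle_is_coboundary : is_disk R M ->
  exists g : vertex M -> bool,
    forall s, c s = g (vertex_of (side_end s false)) (+) g (vertex_of (side_end s true)).
Proof.
move=> disk.
pose P (x : X) i j := sheet (repr x) i * sheet (repr x) j.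
have PE z i j : P (proj z) i j = sheet z i * sheet z j.
  have [b bE] : exists b, forall i, sheet (repr (proj z)) i = sgb b * sheet z i.
    by apply: sheet_glue; rewrite reprK.
  by rewrite /P !bE mulrACA /sgb -expr2 sqrr_sign mul1r.
have [i j|x|W Wc WP] := @disk_rank_one_section R X sheet_index P disk.
- apply: (repr_comp_continuous (g := fun z => sheet z i * sheet z j)).
    by apply: mulr_continuous; exact: sheet_continuous.
  by move=> z z' /eqP e; rewrite -!PE e.
- by exists (sheet (repr x)) => //; exact: sheet_vector_neq0.
(* The section is a nonzero multiple of [sheet z], so this inner product never vanishes and keeps
   its sign on each square. *)
pose kap z := \sum_i W (proj z) i * sheet z i.
have kap0 z : kap z != 0.
  have [k k0 kE] := WP (proj z) (sheet z) (PE z).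
  rewrite /kap (eq_bigr (fun i => k * (sheet z i * sheet z i))); last first.
    by move=> i _; rewrite kE mulrA.
  rewrite -mulr_sumr mulf_neq0// psumr_neq0.
    have [i ui] := sheet_vector_neq0 (tag z) (set_val (tagged z)).
    by apply/hasP; exists i; rewrite ?mem_index_enum//= -expr2 exprn_even_gt0.
  by move=> j _; rewrite -expr2 sqr_ge0.
have kapc : continuous kap.
  apply: sum_continuous => i; apply: mulr_continuous; last exact: sheet_continuous.
  exact: (comp_continuous (@pi_continuous _ _) (Wc i)).
pose at_ q p : sq := existT (fun=> set_type (@unit_square R)) q (square_clamp p).
have atc q : continuous (fun p => kap (at_ q p)).
  apply: (comp_continuous _ kapc).
  by move=> p U nU; exact: (@square_clamp_continuous R p _ nU).
pose neg q := kap (at_ q (0, 0)) < 0.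
have negE q p : (kap (at_ q p) < 0) = neg q.
  by apply: (neq0_constant_sign (atc q)) => z; exact: kap0.
(* [W] takes the same value at glued points while [sheet] changes by [sgb tau], so the jumps of
   [neg] and [pot] cancel. *)
have negM s b : mate s != s -> neg s.1 (+) pot (side_end s b) =
    neg (mate s).1 (+) pot (side_end (mate s) (b (+) flip s)).
  move=> ms; set tau := pot (side_end s b) (+) pot (side_end (mate s) (b (+) flip s)).
  pose t' : R := if flip s then 1 - 0 else 0.
  pose z := at_ s.1 (side_param s.2 0).
  pose z' := at_ (mate s).1 (side_param (mate s).2 t').
  have sU : unit_square (side_param s.2 (0 : R)).
    by apply: side_param_unit_square; rewrite lexx ler01.
  have s'U : unit_square (side_param (mate s).2 t').
    by apply: side_param_unit_square; rewrite /t'; case: (flip s); rewrite ?subr0 ?lexx ?ler01.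
  have zz' : proj z = proj z'.
    apply/eqmodP => /=; apply/asboolP; apply: rst_step; exists s, 0.
    by rewrite lexx ler01; split=> //; split=> //=;
      rewrite -[RHS]square_clamp_id// set_valE.
  have kE : kap z = sgb tau * kap z'.
    rewrite /kap zz' mulr_sumr; apply: eq_bigr => i _.
    rewrite /sheet /= !square_clamp_id// (sheet_vector_mate b)// mulrCA //.
  have : (kap z < 0) = tau (+) (kap z' < 0).
    rewrite kE /sgb; clear kE; case: tau => /=; last by rewrite expr0 mul1r.
    by rewrite expr1 mulN1r oppr_lt0 -leNgt lt_neqAle eq_sym kap0.
  by rewrite !negE /tau => ->; do 2!case: (pot _); case: (neg _).
(* The corrected potential descends to vertices. Along a side [neg] cancels, since both ends lie in
   one square. *)
pose h (x : corner M) := neg x.1 (+) pot x.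
exists (fun v => h (repr v)) => s.
have hr x : h (repr (vertex_of x)) = h x.
  apply: (vertex_of_ind (v := vertex_of x)) => [s' b ms _||//]; first exact: negM.
  by rewrite /vertex_of reprK.
by rewrite !hr /h /= addbACA addbb addFb local_potential_side.
Qed.
End Potential.

End DiskCohomology.

(** * Paths with interlaced ends *)

Lemma telescope_addb (h : nat -> bool) a c : a <= c ->
  \big[addb/false]_(a <= i < c) (h i (+) h i.+1) = h a (+) h c.
Proof.
elim: c => [|c IH]; first by rewrite leqn0 => /eqP ->; rewrite big_geq// addbb.
rewrite leq_eqVlt => /predU1P[->|ac]; first by rewrite big_geq// addbb.
by rewrite big_nat_recr//= IH// addbA addbK.
Qed.

#[local] Opaque vertex edge.

Section Jordan.
Variable M : square_surface.
Local Notation edge_of := (@edge_of M).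
Local Notation vertex_of := (@vertex_of M).
Hypothesis H1 : forall c : edge M -> bool,
  (forall q, \big[addb/false]_(k < 4) c (edge_of (q, k)) = false) ->
  exists g, forall e, c e = coboundary g e.
Variables (m : nat) (pt : 'I_m -> vertex M) (be : 'I_m -> edge M).
Hypothesis be_inj : injective be.
Hypothesis be_bd : forall e, reflect (exists i, e = be i) (e \in boundary_edges M).
Hypothesis be_ends : forall i, edge_ends (be i) = [set pt i; pt (ordS i)].

(** [z] counts mod 2 the edges chosen along the walk. Its boundary is expressed by pairing with
    coboundaries, as [cycle_is_boundary] requires. *)
Lemma walk_chain (x : vertex M) (p : seq (vertex M)) : path (@adj (skeleton M)) x p ->
  exists z : edge M -> bool,
    (forall g, \big[addb/false]_e (z e && coboundary g e) = g x (+) g (last x p)) /\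
    (forall e (v : vertex M), z e -> v \in edge_ends e -> v \in x :: p).
Proof.
elim: p x => [|y p IH] x /=.
  move=> _; exists (fun=> false); split=> // g.
  by rewrite addbb big1.
move=> /andP[/existsP[e0 /eqP e0E'] yp].
  have e0E : edge_ends e0 = [set x; y] := e0E'.
  have [z [zg zs]] := IH y yp.
exists (fun e => (e == e0) (+) z e); split=> [g|e v].
  under eq_bigr do rewrite andb_addl.
  rewrite big_split /= zg (bigD1 e0)//= eqxx big1 ?addbF; last by move=> e /negbTE ->.
  by rewrite /= (coboundary_ends g e0E) -addbA addKb.
have [->|ee] := eqVneq e e0 => /=.
  by move=> _; rewrite e0E => /set2P[]->; rewrite !in_cons eqxx ?orbT.
by move=> ze /(zs _ _ ze) vp; rewrite in_cons vp orbT.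
Qed.

Definition arc_chain (a c : nat) (e : edge M) : bool :=
  \big[addb/false]_(i < m | a <= i < c) (e == be i).

Lemma arc_chain_be a c i : arc_chain a c (be i) = (a <= i < c).
Proof.
rewrite /arc_chain big_mkcond (bigD1 i)//= eqxx big1 ?addbF; first by case: ifP.
by move=> j /negbTE ji; rewrite (inj_eq be_inj) eq_sym ji if_same.
Qed.

Lemma arc_chain_interior a c e : e \notin boundary_edges M -> arc_chain a c e = false.
Proof.
move=> eb; apply: big1 => i _; apply: contraNF eb => /eqP ->.
by apply/be_bd; exists i.
Qed.

Lemma arc_chain_sum (a c : 'I_m) g : a <= c ->
  \big[addb/false]_e (arc_chain a c e && coboundary g e) = g (pt a) (+) g (pt c).
Proof.
move=> ac.
transitivity (\big[addb/false]_(i < m | a <= i < c) coboundary g (be i)).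
  under eq_bigr do rewrite big_distrl /=.
  rewrite exchange_big /=; apply: eq_bigr => i _.
  rewrite (bigD1 (be i))//= eqxx big1 ?addbF// => e /negbTE -> //.
(* Extends the boundary vertices to [nat] for telescoping. All indices are at most [c < m], so the
   default is not reached and [ordS] does not wrap. *)
pose h k := oapp (fun i => g (pt i)) false (insub k : option 'I_m).
have hE (i : 'I_m) : h i = g (pt i) by rewrite /h valK.
rewrite -!hE -telescope_addb//.
rewrite [RHS](@big_nat_widenl _ _ _ _ 0)// (@big_nat_widen _ _ _ _ _ m) ?big_mkord;
  last exact: ltnW.
apply: eq_big => [i|i /andP[_ ic]]; first by rewrite andbC.
rewrite (coboundary_ends g (be_ends i)) -!hE; congr (_ (+) h _).
by rewrite /= modn_small// (leq_ltn_trans ic).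
Qed.

(** If the paths are disjoint, [P] and the boundary arc from [a] to [c] bound a set [S] of squares.
    As [Q] avoids [P], membership in [S] is constant along [Q]; but [S] contains a square at [pt b]
    and misses one at [pt d]. *)
Lemma interlaced_paths_meet (a b c d : 'I_m) P Q :
  a < b < c -> (d < a) || (c < d) ->
  path (@adj (skeleton M)) (pt a) P -> last (pt a) P = pt c ->
  path (@adj (skeleton M)) (pt b) Q -> last (pt b) Q = pt d ->
  exists2 v, v \in pt a :: P & v \in pt b :: Q.
Proof.
move=> /andP[ab bc] dac aP Pc bQ Qd; apply: contrapT => nmeet.
have QP v : v \in pt b :: Q -> v \notin pt a :: P.
  by move=> vQ; apply/negP => vP; apply: nmeet; exists v.
have [zP [zPg zPs]] := walk_chain aP.
have ac : a <= c by lia.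
have [|S SE] := cycle_is_boundary H1 (z := fun e => zP e (+) arc_chain a c e).
  move=> g; under eq_bigr do rewrite andb_addl.
  by rewrite big_split /= zPg arc_chain_sum// Pc addbb.
have end_in s t : vertex_of (side_end s t) \in edge_ends (edge_of s).
  by rewrite edge_ends_side; case: t; rewrite !inE eqxx ?orbT.
have zP0 s t : vertex_of (side_end s t) \in pt b :: Q -> zP (edge_of s) = false.
  by move=> /QP; apply: contraNF => /zPs; apply.
(* Around a vertex of [Q], no interior edge belongs to the cycle, so [S] does not change across
   it. *)
have star v : v \in pt b :: Q ->
    forall x y, vertex_of x = v -> vertex_of y = v -> S x.1 = S y.1.
  move=> vQ; apply: vertex_of_ind => s t ms sv /=.
  have := SE s; rewrite (zP0 s t) ?sv// arc_chain_interior ?ms /=.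
    by case: (S _) (S _) => [] [].
  apply/imsetP => -[s']; rewrite inE => /eqP ms' /eq_edge_of[] e.
    by rewrite -e ms' eqxx in ms.
  by rewrite -[s]mateK -e !ms' eqxx in ms.
(* A boundary edge has only one square, so there [S] is read off from the arc alone. *)
have at_pt i : pt i \in pt b :: Q ->
    exists2 x, vertex_of x = pt i & S x.1 = (a <= i < c).
  move=> iQ; have /imsetP[s] : be i \in boundary_edges M by apply/be_bd; exists i.
  rewrite inE => /eqP ms sE.
  have is_ : pt i \in edge_ends (edge_of s) by rewrite -sE be_ends !inE eqxx.
  have /= := SE s; rewrite ms eqxx /= addbF -[edge_of s]sE arc_chain_be => SsE.
  have at_end t : pt i = vertex_of (side_end s t) ->
      exists2 x, vertex_of x = pt i & S x.1 = (a <= i < c).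
    move=> it; exists (side_end s t) => //=.
    by rewrite -SsE sE (zP0 s t) ?addFb // -it.
  by move: is_; rewrite edge_ends_side !inE => /orP[] /eqP; exact: at_end.
(* Consecutive vertices of [Q] are ends of one side, hence corners of a common square. *)
have along : forall v p x, path (@adj (skeleton M)) v p -> {subset v :: p <= pt b :: Q} ->
    vertex_of x = v -> forall y, vertex_of y = last v p -> S x.1 = S y.1.
  move=> v p; elim: p v => [|w p IH] v x /=.
    by move=> _ vQ xv y yv; apply: (star v) => //; apply: vQ; rewrite inE.
  move=> /andP[/existsP[e /eqP /= eE] wp] sub xv y yl.
  have vQ : v \in pt b :: Q by apply: sub; rewrite inE eqxx.
  pose s := repr e.
  have : w \in edge_ends (edge_of s) by rewrite edge_of_repr eE !inE eqxx orbT.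
  have : v \in edge_ends (edge_of s) by rewrite edge_of_repr eE !inE eqxx.
  rewrite edge_ends_side !inE.
  have go t t' : v = vertex_of (side_end s t) -> w = vertex_of (side_end s t') ->
      S x.1 = S y.1.
    move=> vt wt; rewrite (star v vQ x (side_end s t))//.
    transitivity (S (side_end s t').1) => //.
    apply: (IH w) => // z zp; apply: sub; rewrite inE zp orbT //.
  by move=> /orP[]/eqP vt /orP[]/eqP wt; apply: go vt wt.
have [|x xb Sx] := at_pt b; first by rewrite inE eqxx.
have [|y yd Sy] := at_pt d; first by rewrite -Qd mem_last.
have := along (pt b) Q x bQ (fun _ => id) xb y; rewrite Qd => /(_ yd).
rewrite Sx Sy; move: ab bc dac; case: leqP => //; lia.
Qed.

End Jordan.

(** * Crossings inside a square *)

(** Parity of the winding number of [(a, b)] along the boundary of a square,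
    counted by the changes of [a] on the side [b = true]. When [a] and [b]
    change at once and in opposite directions, this amounts to passing through
    [(false, false)], which makes the count symmetric in [a] and [b]. *)
Definition crossing (a b : 'I_4 -> bool) : bool :=
  \big[addb/false]_(k < 4)
    ((a k (+) a (ordS k)) && (b k && b (ordS k))).

Local Notation quad := (bool * bool * bool * bool)%type.

Definition all_quads : seq quad :=
  let bs := [:: false; true] in
  [seq (p, d) | p <- [seq (p, c) | p <- [seq (a, b) | a <- bs, b <- bs], c <- bs], d <- bs].

Lemma mem_all_quads q : q \in all_quads.
Proof. by case: q => [[[[] []] []] []]. Qed.

Definition quad_ups (q : quad) : seq bool :=
  let: (a, b, c, d) := q in [:: ~~ a && b; ~~ b && c; ~~ c && d; ~~ d && a].

Definition quad_neg (q : quad) : quad :=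
  let: (a, b, c, d) := q in (~~ a, ~~ b, ~~ c, ~~ d).

(** Negation turns descents into ascents, so both directions are covered. *)
Definition quad_compat (q r : quad) : bool :=
  all2 (fun x y => ~~ (x && y)) (quad_ups q) (quad_ups r) &&
  all2 (fun x y => ~~ (x && y)) (quad_ups (quad_neg q)) (quad_ups (quad_neg r)).

Definition quad_crossing (q r : quad) : bool :=
  let: (a, b, c, d) := q in let: (a', b', c', d') := r in
  ((a (+) b) && (a' && b')) (+) ((b (+) c) && (b' && c')) (+)
  ((c (+) d) && (c' && d')) (+) ((d (+) a) && (d' && a')).

(** The nested implications prune the enumeration of quadruples as soon as an incompatible pair
    occurs. *)
Definition quad_check : bool :=
  all (fun p => all (fun q => quad_compat p q ==>
  all (fun r => quad_compat p r && quad_compat q r ==>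
  all (fun s => [&& quad_compat p s, quad_compat q s & quad_compat r s] ==>
    (quad_crossing p q + quad_crossing p r + quad_crossing p s
     + quad_crossing q r + quad_crossing q s + quad_crossing r s <= 4))
  all_quads) all_quads) all_quads) all_quads.

Lemma quad_checkT : quad_check. Proof. by vm_compute. Qed.

Lemma quad_crossing_le4 p q r s :
  quad_compat p q -> quad_compat p r -> quad_compat p s ->
  quad_compat q r -> quad_compat q s -> quad_compat r s ->
  quad_crossing p q + quad_crossing p r + quad_crossing p s
     + quad_crossing q r + quad_crossing q s + quad_crossing r s <= 4.
Proof.
move=> pq pr ps qr qs rs.
have /allP/(_ p (mem_all_quads p))/allP/(_ q (mem_all_quads q)) := quad_checkT.
rewrite pq => /allP/(_ r (mem_all_quads r)); rewrite pr qr.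
by move=> /allP/(_ s (mem_all_quads s)); rewrite ps qs rs.
Qed.

Section LocalCount.
Variables (m : nat) (col : 'I_m -> 'I_4 -> bool).
Hypothesis ups : forall k i j, ~~ col i k -> col i (ordS k) ->
  ~~ col j k -> col j (ordS k) -> i = j.
Hypothesis downs : forall k i j, col i k -> ~~ col i (ordS k) ->
  col j k -> ~~ col j (ordS k) -> i = j.
Local Notation o k := (@Ordinal 4 k isT).

Let quad_of i : quad := (col i (o 0), col i (o 1), col i (o 2), col i (o 3)).

Let ordS4 : (ordS (o 0) = o 1) * (ordS (o 1) = o 2) * (ordS (o 2) = o 3) * (ordS (o 3) = o 0).
Proof. by do !split; apply/val_inj. Qed.

Let crossing_quad i j : crossing (col i) (col j) = quad_crossing (quad_of i) (quad_of j).
Proof.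
rewrite /crossing !big_ord_recl big_ord0 addbF.
have -> : ord0 = o 0 by exact/val_inj.
have -> : lift (o 0) ord0 = o 1 by exact/val_inj.
have -> : lift (o 0) (lift ord0 ord0) = o 2 by exact/val_inj.
have -> : lift (o 0) (lift ord0 (lift ord0 ord0)) = o 3 by exact/val_inj.
by rewrite !ordS4 /quad_of /quad_crossing !addbA.
Qed.

Let compat i j : i != j -> quad_compat (quad_of i) (quad_of j).
Proof.
move=> ij; have U k : ~~ [&& ~~ col i k, col i (ordS k), ~~ col j k & col j (ordS k)].
  by apply: contraNN ij => /and4P[h1 h2 h3 h4]; apply/eqP; exact: (ups h1).
have D k : ~~ [&& col i k, ~~ col i (ordS k), col j k & ~~ col j (ordS k)].
  by apply: contraNN ij => /and4P[h1 h2 h3 h4]; apply/eqP; exact: (downs h1).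
move: (U (o 0)) (U (o 1)) (U (o 2)) (U (o 3)) (D (o 0)) (D (o 1)) (D (o 2)) (D (o 3)).
rewrite !ordS4 /quad_compat /quad_of /= !andbT !negbK.
by move=> *; apply/andP; split; apply/and4P; split; rewrite -andbA.
Qed.

(** A cyclic pattern without ascent is constant, so these are the walls that cut the square. *)
Let active : {set 'I_m} := [set i | quad_ups (quad_of i) != [:: false; false; false; false]].

Let active_crossing i j : crossing (col i) (col j) -> (i \in active) && (j \in active).
Proof.
rewrite crossing_quad !inE /quad_of.
by case: (col i _) (col i _) (col i _) (col i _) (col j _) (col j _) (col j _) (col j _)
  => [] [] [] [] [] [] [] [].
Qed.

(** Each active pattern picks a side on which it ascends; by [ups] the choice is injective into the
    four sides. *)
Let card_active : #|active| <= 4.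
Proof.
pose up i k := ~~ col i k && col i (ordS k).
pose h i : 'I_4 := odflt ord0 [pick k | up i k].
have hP i : i \in active -> up i (h i).
  rewrite inE /h; case: pickP => // nup.
  have U k : up i k = false by exact: nup.
  move: (U (o 0)) (U (o 1)) (U (o 2)) (U (o 3)).
  by rewrite /up !ordS4 /quad_of /= => -> -> -> ->.
rewrite -(card_in_imset (f := h)); first by rewrite -[leqRHS]card_ord max_card.
move=> i j /hP/andP[i1 i2] /hP/andP[j1 j2] hij; rewrite hij in i1 i2.
exact: (ups i1).
Qed.

Lemma local_crossing_count :
  #|[set p : 'I_m * 'I_m | (p.1 < p.2) && crossing (col p.1) (col p.2)]| <= 4.
Proof.
pose F (i j : 'I_m) : nat := (i < j) && crossing (col i) (col j).
have -> : #|[set p : 'I_m * 'I_m | (p.1 < p.2) && crossing (col p.1) (col p.2)]| =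
    \sum_(i in active) \sum_(j in active) F i j.
  rewrite -sum1_card pair_big_dep /= big_mkcond [RHS]big_mkcond /=.
  apply: eq_bigr => -[i j] _; rewrite inE /F /=.
  have := @active_crossing i j; case: (crossing _ _) => /=; last by rewrite andbF; case: ifP.
  by move=> /(_ isT) ->; case: (i < j).
under eq_bigr do rewrite -big_enum /=.
rewrite -big_enum /=.
have : sorted (fun i j : 'I_m => i < j) (enum active).
  apply: sorted_filter; first by move=> ? ? ?; exact: ltn_trans.
  have := iota_ltn_sorted 0 m; rewrite -val_enum_ord sorted_map.
  by rewrite enumT.
have := card_active; rewrite cardE.
have Fii i : F i i = 0 by rewrite /F ltnn.
have Fgt (i j : 'I_m) : i < j -> F j i = 0 by move=> ij; rewrite /F ltnNge ltnW.
have Flt (i j : 'I_m) : i < j -> F i j = quad_crossing (quad_of i) (quad_of j).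
  by move=> ij; rewrite /F ij crossing_quad.
have lt_compat (i j : 'I_m) : i < j -> quad_compat (quad_of i) (quad_of j).
  by move=> ij; apply: compat; rewrite -val_eqE neq_ltn ij.
(* Up to three patterns form at most three pairs; only four patterns need [quad_crossing_le4]. *)
case: (enum active) => [|a [|b [|c [|d [|//]]]]] _ /=;
  rewrite ?big_cons ?big_nil // ?Fii //.
- by rewrite andbT => /Fgt ->; rewrite /F; case: (_ && _).
- move=> /and3P[ab bc _]; have ac := ltn_trans ab bc.
  by rewrite !(Fgt _ _ ab) !(Fgt _ _ bc) !(Fgt _ _ ac) /F; do 3!case: (_ && _).
- move=> /and4P[ab bc cd _]; have ac := ltn_trans ab bc.
  have bd := ltn_trans bc cd; have ad := ltn_trans ab bd.
  rewrite !(Fgt _ _ ab) !(Fgt _ _ bc) !(Fgt _ _ ac) !(Fgt _ _ bd) !(Fgt _ _ cd) !(Fgt _ _ ad).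
  rewrite !Flt//.
  have := quad_crossing_le4 (lt_compat _ _ ab) (lt_compat _ _ ac) (lt_compat _ _ ad)
    (lt_compat _ _ bc) (lt_compat _ _ bd) (lt_compat _ _ cd).
  by rewrite !addn0 !add0n !addnA.
Qed.
End LocalCount.

(** * Distances in a cycle *)

Lemma val_ordS m (i : 'I_m) : ordS i = (if i.+1 == m then 0 else i.+1) :> nat.
Proof.
have im := ltn_ord i; rewrite /=; case: eqP => [->|ne]; first by rewrite modnn.
by rewrite modn_small//; lia.
Qed.

Section CycleDistance.
Variable m : nat.
Local Notation C := (cycle_graph m).

Definition forward_distance (i l : nat) : nat := if i <= l then l - i else l + m - i.

Definition cycle_distance (i l : nat) : nat :=
  minn (forward_distance i l) (m - forward_distance i l).

Lemma adj_cycle (x y : 'I_m) : @adj C x y -> y = ordS x \/ x = ordS y.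
Proof.
move=> /existsP[e /eqP /= eE].
have: x \in [set e; ordS e] by rewrite eE !inE eqxx.
have: y \in [set e; ordS e] by rewrite eE !inE eqxx orbT.
have: ordS e \in [set x; y] by rewrite -eE !inE eqxx orbT.
have: e \in [set x; y] by rewrite -eE !inE eqxx.
rewrite !inE {eE}; do 4!(move=> /orP[]/eqP ?); subst; auto.
Qed.

(** Each step raises [cycle_distance] by at most 1, which bounds path lengths from below. *)
Lemma cycle_distance_path (i x : 'I_m) p : path (@adj C) x p ->
  cycle_distance i (last x p : 'I_m) <= cycle_distance i x + size p.
Proof.
elim: p x => [|y p IH] x /=; first by rewrite addn0.
move=> /andP[/adj_cycle xy /IH] /leq_trans; apply.
rewrite addnS -addSn leq_add2r /cycle_distance /forward_distance.
have xm := ltn_ord x; have ym := ltn_ord y; have im := ltn_ord i.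
case: xy => e; have := congr1 (@nat_of_ord m) e; rewrite val_ordS.
  by case: eqP; do 2!case: ifP; lia.
by case: eqP; do 2!case: ifP; lia.
Qed.

Lemma has_path_forward (i l : 'I_m) : @has_path C i l (forward_distance i l).
Proof.
have it k : @has_path C i (iter k (@ordS m) i) k.
  elim: k => [|k IH]; first by apply/has_pathP; exists [::].
  rewrite -addn1 addn1 iterS -addn1; apply: has_path_cat IH _.
  apply/has_pathP; exists [:: ordS (iter k (@ordS m) i)]; split=> //=.
  by rewrite andbT; apply/existsP; exists (iter k (@ordS m) i).
have itE k : val (iter k (@ordS m) i) = (i + k) %% m.
  elim: k => [|k IH]; first by rewrite addn0 modn_small.
  by rewrite iterS [LHS]/= [nat_of_ord _]IH -addn1 modnDml addn1 addnS.
suff e : iter (forward_distance i l) (@ordS m) i = l by rewrite -[X in has_path _ X]e.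
apply/val_inj; rewrite itE /forward_distance /=.
have lm := ltn_ord l; have im := ltn_ord i.
case: leqP => il; first by rewrite subnKC ?modn_small.
by rewrite subnKC ?modnDr ?modn_small//; lia.
Qed.

Lemma distn_cycle (i l : 'I_m) : @distn C i l = cycle_distance i l.
Proof.
have lm := ltn_ord l; have im := ltn_ord i.
have li : linked (i : vtx C) l by exists (forward_distance i l); exact: has_path_forward.
apply/eqP; rewrite eqn_leq; apply/andP; split.
  have := distn_le (has_path_forward i l).
  have := distn_le (has_path_sym (has_path_forward l i)).
  rewrite /cycle_distance /forward_distance; do 2!case: ifP; lia.
have /has_pathP[p [ip <- <-]] := distn_path li.
have := cycle_distance_path i ip.
by rewrite {2}/cycle_distance /forward_distance leqnn subnn min0n add0n.
Qed.

(** The vertices nearer to [i + 1] are the [n] successors of [i]; the second disjunct holds those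
    past the wraparound. *)
Lemma cycle_distance_ordS n (i l : 'I_m) : 0 < n -> m = 2 * n ->
  (cycle_distance (ordS i) l < cycle_distance i l) =
  (i < l <= i + n) || (l + m <= i + n).
Proof.
move=> n0 mE; have lm := ltn_ord l; have im := ltn_ord i.
rewrite val_ordS /cycle_distance /forward_distance.
by case: eqP => e; rewrite ?leq0n ?subn0; do ?case: ifP => ?; apply/idP/idP; lia.
Qed.

End CycleDistance.

(** * Walls *)

#[local] Opaque distn.

(** Used to exclude ties: distances to neighbours differ by at most one and in parity. *)
Lemma parity_step a b d (x s t : bool) : s (+) t -> odd a = x (+) s ->
  odd b = x (+) t -> d <= 1 -> a <= b + d -> b <= a + d -> b = a.+1 \/ a = b.+1.
Proof.
move=> st oa ob d1 ab ba.
have /eqP ne : a != b.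
  by apply: contraTneq st => e; move: oa; rewrite e ob; case: x s t {ob} => [] [] [].
lia.
Qed.

(** The summand of [crossing] on one edge; its symmetry makes [edge_fun] and [mod2_stokes]
    applicable. *)
Definition crossing_form (T : Type) (a b : T -> bool) (u v : T) : bool :=
  (a u (+) a v) && (b u && b v).

Lemma crossing_form_sym (T : Type) (a b : T -> bool) : symmetric (crossing_form a b).
Proof. by move=> u v; rewrite /crossing_form addbC (andbC (b u)). Qed.

Section Filling.
Variable M : square_surface.
Local Notation edge_of := (@edge_of M).
Local Notation vertex_of := (@vertex_of M).
Local Notation G := (skeleton M).
Hypothesis H1 : forall c : edge M -> bool,
  (forall q, \big[addb/false]_(k < 4) c (edge_of (q, k)) = false) ->
  exists g, forall e, c e = coboundary g e.
Variables (m : nat) (pt : 'I_m -> vertex M) (be : 'I_m -> edge M).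
Hypothesis be_inj : injective be.
Hypothesis be_bd : forall e, reflect (exists i, e = be i) (e \in boundary_edges M).
Hypothesis be_ends : forall i, edge_ends (be i) = [set pt i; pt (ordS i)].
Hypothesis pt_linked : forall i j, @linked G (pt i) (pt j).
Implicit Types (u v x : vertex M).

Lemma skeleton_bipartite : exists g : vertex M -> bool,
  (forall x y, @adj G x y -> g x (+) g y) /\
  forall x y, @linked G x y -> odd (@distn G x y) = g x (+) g y.
Proof.
have [q|g gE] := H1 (c := fun=> true); first by rewrite !big_ord_recl big_ord0.
have g_adj x y : @adj G x y -> g x (+) g y.
  move=> /existsP[e /eqP eE].
  by rewrite -(coboundary_ends g (eE : edge_ends e = [set x; y])) -gE.
exists g; split=> // x y xy.
have /has_pathP[p [xp <- <-]] := distn_path xy.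
elim: p x xp {xy} => [|z p IH] x /=; first by rewrite addbb.
by move=> /andP[/g_adj + /IH ->]; case: (g x); case: (g z); case: (g (last z p)).
Qed.

Definition depth (i : 'I_m) v : nat := @distn G (pt i) v.

(** Vertices not linked to the boundary have both depths 0 and fall on the false side. *)
Definition side_of (i : 'I_m) v : bool := depth (ordS i) v < depth i v.

Lemma pt_adj i : @adj G (pt i) (pt (ordS i)).
Proof. by apply/existsP; exists (be i); apply/eqP; exact: be_ends. Qed.

Lemma depth_adj i u v : @linked G (pt i) u -> @adj G u v ->
  depth i v = (depth i u).+1 \/ depth i u = (depth i v).+1.
Proof.
move=> iu uv; have [g [ga gE]] := skeleton_bipartite.
have uvl := linked_adj uv; have iv := linked_trans iu uvl.
apply: (parity_step (ga _ _ uv) (gE _ _ iu) (gE _ _ iv) (distn_adj uv)).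
  by rewrite [@distn G u v]distn_sym; exact: distn_triangle iv (linked_sym uvl).
exact: distn_triangle iu uvl.
Qed.

Lemma depth_ordS i v : @linked G (pt i) v ->
  depth (ordS i) v = (depth i v).+1 \/ depth i v = (depth (ordS i) v).+1.
Proof.
move=> iv; rewrite /depth ![@distn G _ v]distn_sym.
have [g [ga gE]] := skeleton_bipartite.
have a := pt_adj i; have vi := linked_sym iv; have ii := linked_adj a.
have vSi := linked_trans vi ii.
apply: (parity_step (ga _ _ a) (gE _ _ vi) (gE _ _ vSi) (distn_adj a)).
  by rewrite [@distn G (pt i) (pt _)]distn_sym; exact: distn_triangle vSi (linked_sym ii).
exact: distn_triangle vi ii.
Qed.

Lemma linked_any i j v : @linked G (pt i) v -> @linked G (pt j) v.
Proof. exact: linked_trans. Qed.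

(** Otherwise passing through [x] would reach [v] from [pt i] within [depth i u] steps. *)
Lemma geodesic_nearer i u v x : @linked G (pt i) u -> @adj G u v ->
  depth i u < depth i v -> @linked G (pt i) x -> @linked G x u ->
  depth i x + @distn G x u = depth i u -> @distn G x u < @distn G x v.
Proof.
move=> iu uv duv ix xu dx.
have := distn_triangle ix (linked_trans xu (linked_adj uv)); rewrite -/(depth i x).
by rewrite -/(depth i v); lia.
Qed.

Lemma nearer_path i j u v : @linked G (pt i) u -> @adj G u v ->
  depth i u < depth i v -> depth j u < depth j v ->
  exists p, [/\ path (@adj G) (pt i) p, last (pt i) p = pt j &
    forall x, x \in pt i :: p -> @distn G x u < @distn G x v].
Proof.
move=> iu uv di dj; have ju := linked_any j iu.
have [p [ip pu pP]] := geodesic iu.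
have [q [uq qj qP]] := geodesic (linked_sym ju).
exists (p ++ q); rewrite cat_path last_cat pu ip uq.
split; [by []|exact: qj|move=> x].
rewrite -cat_cons mem_cat => /orP[/pP[ix xu dx]|xq].
  exact: (geodesic_nearer iu uv di).
have [|ux xj dx] := qP x; first by rewrite inE xq orbT.
apply: (geodesic_nearer ju uv dj); [exact: linked_sym|exact: linked_sym|].
by rewrite /depth ![@distn G (pt j) _]distn_sym [@distn G x u]distn_sym addnC.
Qed.

Lemma side_of_linked i v : side_of i v -> @linked G (pt i) v.
Proof.
move=> iv; apply: contrapT => nl; move: iv; rewrite /side_of /depth.
rewrite [X in _ < X]distn_unlinked ?ltn0//.
Qed.

(** All four neighbouring depths differ by exactly one. If [depth i] fell from [u] to [v], then
    [depth (ordS i)] would have to fall by three. *)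
Lemma side_of_jump i u v : @adj G u v -> ~~ side_of i u -> side_of i v ->
  [/\ @linked G (pt i) u, depth i u < depth i v & depth (ordS i) v < depth (ordS i) u].
Proof.
move=> uv iu iv; have liv := side_of_linked iv.
have liu : @linked G (pt i) u by apply: linked_trans liv (linked_sym (linked_adj uv)).
have h1 := depth_adj liu uv.
have h2 := depth_adj (linked_any (ordS i) liu) uv.
have h3 := depth_ordS liu.
have h4 := depth_ordS liv.
move: iu iv h1 h2 h3 h4; rewrite /side_of.
move: (depth i u) (depth i v) (depth (ordS i) u) (depth (ordS i) v) => a b c d.
by move=> iu iv h1 h2 h3 h4; split; [exact: liu|lia|lia].
Qed.

Lemma side_of_inj i j u v : @adj G u v -> ~~ side_of i u -> side_of i v ->
  ~~ side_of j u -> side_of j v -> i = j.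
Proof.
move=> uv; wlog ij : i j / i < j.
  move=> wl iu iv ju jv; have [ij|ji|/val_inj//] := ltngtP i j; first exact: wl.
  by apply/esym/wl.
move=> iu iv ju jv; exfalso.
have [li di dSi] := side_of_jump uv iu iv.
have [lj dj dSj] := side_of_jump uv ju jv.
have vu : @adj G v u by rewrite adj_sym.
have lv : @linked G (pt (ordS i)) v.
  by apply: linked_any (linked_trans li (linked_adj uv)).
have [P [iP Pj PP]] := nearer_path li uv di dj.
have [Q [iQ Qj QP]] := nearer_path lv vu dSi dSj.
have jm := ltn_ord j.
(* If [ordS i = j], its depth would both fall and rise from [u] to [v]; likewise for [ordS j = i].
   This makes the ends strictly interlaced. *)
have Sij : ordS i != j by apply: contraTneq dSi => ->; rewrite -leqNgt ltnW.
have Sji : ordS j != i by apply: contraTneq dSj => ->; rewrite -leqNgt ltnW.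
have nSij : ordS i != j :> nat by [].
have nSji : ordS j != i :> nat by [].
have Sib : i < ordS i < j.
  move/eqP: nSij; rewrite val_ordS; clear -ij jm; case: eqP; lia.
have Sjd : (ordS j < i) || (j < ordS j).
  move/eqP: nSji; rewrite val_ordS; clear -ij jm; case: eqP; lia.
have [x xP xQ] := interlaced_paths_meet H1 be_inj be_bd be_ends Sib Sjd iP Pj iQ Qj.
by have := ltn_trans (PP x xP) (QP x xQ); rewrite ltnn.
Qed.

Lemma adj_side q k : @adj G (vertex_of (q, k)) (vertex_of (q, ordS k)).
Proof. by apply/existsP; exists (edge_of (q, k)); rewrite /= edge_ends_side. Qed.

Definition corner_side_of (q : cell M) (i : 'I_m) (k : 'I_4) := side_of i (vertex_of (q, k)).

Lemma cell_crossing_count q :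
  #|[set p : 'I_m * 'I_m | (p.1 < p.2) &&
      crossing (corner_side_of q p.1) (corner_side_of q p.2)]| <= 4.
Proof.
apply: local_crossing_count => k i j.
  exact: side_of_inj (adj_side q k).
(* A descent is an ascent along the reversed edge. *)
move=> i1 i2 j1 j2; apply: side_of_inj i2 i1 j2 j1.
by rewrite adj_sym; exact: adj_side.
Qed.

Variable n : nat.
Hypothesis n0 : 0 < n.
Hypothesis mE : m = 2 * n.
Hypothesis pt_dist : forall i j, @distn G (pt i) (pt j) = cycle_distance m i j.

Lemma side_of_pt i l : side_of i (pt l) = (i < l <= i + n) || (l + m <= i + n).
Proof. by rewrite /side_of /depth !pt_dist (cycle_distance_ordS _ _ n0 mE). Qed.

(** By [mod2_stokes] only boundary edges count, and wall [i] changes only at the edges [i] and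
    [i + n]. As [j] is neither of these, exactly one of the two edges has both ends on the true side
    of wall [j]. *)
Lemma crossing_sum (i j : 'I_m) : i < j -> j <> i + n :> nat ->
  \big[addb/false]_(q : cell M) crossing (corner_side_of q i) (corner_side_of q j) = true.
Proof.
move=> ij jin.
pose F := crossing_form (side_of i) (side_of j).
have Fsym : symmetric F by exact: crossing_form_sym.
transitivity (\big[addb/false]_(q : cell M) \big[addb/false]_(k < 4) edge_fun F (edge_of (q, k))).
  by apply: eq_bigr => q _; apply: eq_bigr => k _; rewrite edge_fun_side.
rewrite mod2_stokes.
transitivity (\big[addb/false]_(l < m) F (pt l) (pt (ordS l))).
  have -> : boundary_edges M = [set be l | l in 'I_m].
    apply/setP => e; apply/be_bd/imsetP => [[l ->]|[l _ ->]]; last by exists l.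
    by exists l.
  rewrite big_imset /=; last by move=> ? ? _ _; exact: be_inj.
  by apply: eq_bigr => l _; rewrite (edge_fun_ends Fsym (be_ends l)).
have jm := ltn_ord j; have im := ltn_ord i.
have i'm : (if i < n then i + n else i - n) < m by clear -im mE; case: ifP; lia.
(* The antipode [i + n] modulo [2 n]. *)
have [i' i'E] : exists i' : 'I_m, i' = (if i < n then i + n else i - n) :> nat.
  by exists (Ordinal i'm).
have F0 l : l != i -> l != i' -> F (pt l) (pt (ordS l)) = false.
  move=> li li'; have {}li : l <> i :> nat by move=> e; move/eqP: li; apply; exact/val_inj.
  have {}li' : l <> i' :> nat by move=> e; move/eqP: li'; apply; exact/val_inj.
  have lm := ltn_ord l.
  have e : side_of i (pt l) = side_of i (pt (ordS l)).
    rewrite !side_of_pt val_ordS; rewrite i'E in li'; clear -li li' lm im n0 mE.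
    by move: li'; case: ifP => c; case: eqP => e li'; lia.
  by rewrite /F /crossing_form e addbb.
have ii' : i' != i.
  by apply/eqP => e; have := congr1 (@nat_of_ord m) e; rewrite i'E; clear -im mE n0; case: ifP; lia.
rewrite (bigD1 i) // (bigD1 i') // big1; last by move=> l /andP[/andP[_ h] /(F0 _ h)].
have FE l : F (pt l) (pt (ordS l)) =
    (((i < l <= i + n) || (l + m <= i + n)) (+)
     ((i < ordS l <= i + n) || (ordS l + m <= i + n))) &&
    (((j < l <= j + n) || (l + m <= j + n)) &&
     ((j < ordS l <= j + n) || (ordS l + m <= j + n))).
  rewrite /F /crossing_form (side_of_pt i l) (side_of_pt i (ordS l)).
  by rewrite (side_of_pt j l) (side_of_pt j (ordS l)).
change (F (pt i) (pt (ordS i)) (+) (F (pt i') (pt (ordS i')) (+) false) = true).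
rewrite (FE i) (FE i') addbF (val_ordS i) (val_ordS i') i'E.
clear -im jm ij jin mE n0.
by case: (ltnP i n) => c; do ?[case: eqP => ?]; lia.
Qed.

End Filling.

(** * Counting *)

Lemma card_ord_gt m (i : 'I_m) : #|[pred j : 'I_m | i < j]| = m - i.+1.
Proof.
rewrite -sum1_card -(big_mkord (fun j => i < j) (fun=> 1)).
by rewrite -[RHS]muln1 -sum_nat_const_nat (@big_nat_widenl _ _ _ i.+1 0).
Qed.

(** There are ['C(2 * n, 2)] pairs, of which [n] are antipodal. *)
Lemma card_nonantipodal_pairs n :
  2 * (n * (n - 1)) <=
  #|[set p : 'I_(2 * n) * 'I_(2 * n) | (p.1 < p.2) && (p.2 != p.1 + n :> nat)]|.
Proof.
have [m mE] : exists m, m = 2 * n by exists (2 * n).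
rewrite -mE.
pose P (p : 'I_m * 'I_m) := (p.1 < p.2) && (p.2 != p.1 + n :> nat).
rewrite -sum1_card (eq_bigl P); last by move=> p; rewrite inE.
rewrite -(pair_big_dep xpredT (fun i j : 'I_m => (i < j) && (j != i + n :> nat)) (fun _ _ => 1)) /=.
(* The antipode [i + n] is an index only for [i < n], whence the correction term. *)
have inner (i : 'I_m) :
    m - i.+1 <= \sum_(j < m | (i < j) && (j != i + n :> nat)) 1 + (i < n).
  rewrite sum1_card -card_ord_gt addnC.
  rewrite -(cardID [pred j : 'I_m | j == i + n :> nat] [pred j : 'I_m | i < j]) leq_add//.
    case: (ltnP i n) => c.
      apply/card_le1_eqP => x y; rewrite !inE => /andP[_ /eqP xe] /andP[_ /eqP ye].
      by apply/val_inj; rewrite /= xe ye.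
    rewrite leqn0; apply/eqP/eq_card0 => x; rewrite !inE.
    by apply/negP => /andP[_ /eqP]; have := ltn_ord x; lia.
  by apply/subset_leq_card/subsetP => x; rewrite !inE andbC.
have : \sum_(i < m) (m - i.+1) <=
    \sum_(i < m) (\sum_(j < m | (i < j) && (j != i + n :> nat)) 1 + (i < n)).
  by apply: leq_sum => i _; exact: inner.
rewrite big_split /=.
rewrite -(big_mkord xpredT (fun i => m - i.+1)) -(big_mkord xpredT (fun i => nat_of_bool (i < n))).
have -> : \sum_(0 <= i < m) (m - i.+1) = 'C(m, 2) by rewrite -bin2_sum [RHS]big_nat_rev add0n.
have -> : \sum_(0 <= i < m) nat_of_bool (i < n) = n.
  rewrite -[RHS]subn0 -[RHS]muln1 -sum_nat_const_nat.
  rewrite (@big_nat_widen _ _ _ 0 n m) ?mE ?leq_pmull// [RHS]big_mkcond /=.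
  by apply: eq_bigr => i _; case: (i < n).
by rewrite bin2 mE -mulnA mul2n doubleK; nia.
Qed.

Theorem theorem10p5 (R : realType) (n : nat) (M : square_surface) :
  0 < n ->
  is_disk R M ->
  fills_isometrically M (cycle_graph (2 * n)) ->
  (n * (n - 1)) %/ 2 <= #|cell M|.
Proof.
move=> n0 disk [f fdist].
(* The disk hypothesis enters only here. *)
have H1 (c : edge M -> bool) :
    (forall q, \big[addb/false]_(k < 4) c (edge_of (q, k)) = false) ->
    exists g, forall e, c e = coboundary g e.
  move=> c0.
  have [s|//|g gE] := @cocycle_is_coboundary M (fun s => c (edge_of s)) _ _ R disk.
    by rewrite edge_of_mate.
  by exists g => e; rewrite -[e]edge_of_repr coboundary_side gE.
pose pt (i : 'I_(2 * n)) : vertex M := val (f i).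
pose be (i : 'I_(2 * n)) : edge M := val (iso_edg f i).
have be_inj : injective be.
  by move=> i j /val_inj; exact: bij_inj (iso_edg_bij f) _ _.
have be_bd e : reflect (exists i, e = be i) (e \in boundary_edges M).
  apply: (iffP idP) => [eb|[i ->]]; last exact: valP.
  have [h _ hK] := iso_edg_bij f.
  by exists (h (exist _ e eb)); rewrite /be hK.
have be_ends i : edge_ends (be i) = [set pt i; pt (ordS i)].
  have fE := iso_ends f i; apply/setP => v; rewrite !inE.
  apply/idP/idP => [vi|vi].
    have vb : v \in boundary_vertices M.
      by apply/bigcupP; exists (be i) => //; exact: valP.
    have : (exist _ v vb : vtx (boundary M)) \in ends (iso_edg f i) by rewrite inE.
    rewrite fE => /imsetP[x]; rewrite !inE => /orP[]/eqP -> ve.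
      by rewrite /pt -ve eqxx.
    by rewrite /pt -ve eqxx orbT.
  have : (f i \in ends (iso_edg f i)) && (f (ordS i) \in ends (iso_edg f i)).
    by rewrite fE !imset_f// !inE eqxx ?orbT.
  by rewrite !inE => /andP[h1 h2]; case/orP: vi => /eqP ->.
have pt_dist i j : @dist (skeleton M) (pt i) (pt j) = Some (cycle_distance (2 * n) i j).
  rewrite fdist -distn_cycle distP//.
  by exists (forward_distance (2 * n) i j); exact: has_path_forward.
have pt_linked i j : @linked (skeleton M) (pt i) (pt j).
  have := pt_dist i j; rewrite /dist; case: pselect => //.
have pt_distn i j : @distn (skeleton M) (pt i) (pt j) = cycle_distance (2 * n) i j.
  by apply: Some_inj; rewrite -pt_dist distP.
pose X q := [set p : 'I_(2 * n) * 'I_(2 * n) | (p.1 < p.2) &&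
  crossing (corner_side_of pt q p.1) (corner_side_of pt q p.2)].
have : 2 * (n * (n - 1)) <= #|cell M| * 4.
  apply: leq_trans (card_nonantipodal_pairs n) _.
  apply: leq_trans (_ : #|\bigcup_(q : cell M) X q| <= _).
    apply/subset_leq_card/subsetP => -[i j]; rewrite inE /= => /andP[ij /eqP jin].
    (* An odd total means that the pair crosses in some square. *)
    have := crossing_sum be_inj be_bd be_ends n0 (erefl (2 * n)) pt_distn ij jin.
    apply: contraTT => nX; rewrite big1 // => q _.
    apply: contraNF nX => Xq; apply/bigcupP; exists q => //; rewrite inE /= ij.
    exact: Xq.
  apply: leq_trans (_ : \sum_(q : cell M) #|X q| <= _).
    elim/big_rec2: _ => [|q x y _ IH]; first by rewrite cards0.
    by apply: leq_trans (leq_card_setU _ _) _; rewrite leq_add2l.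
  rewrite -sum_nat_const; apply: leq_sum => q _.
  exact: (cell_crossing_count H1 be_inj be_bd be_ends pt_linked q).
lia.
Qed.
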